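(* Let $(M,g)$ be a pseudo-Riemannian manifold, let $c$ be a symmetric $(0,2)$-tensor field on $M$, and let $T^2M$ be the second-order tangent bundle of $M$ equipped with the deformed 2-nd lift metric $\overline g={}^{II}g+{}^0c$ and the natural integrable nilpotent structure $\widehat\gamma$. Then the triple $(T^2M,\widehat\gamma,\overline g)$ is a plural-holomorphic $B$-manifold.
   Context: All objects are of class $C^\infty$; repeated indices are summed. The second-order tangent bundle $T^2M$ of an $n$-dimensional manifold $M$ is the $3n$-dimensional manifold of all 2-jets at $0$ of maps $\mathbb R\to M$. A chart $(U,x^i)$ of $M$ induces coordinates $(x^i,y^i,z^i)$ on the preimage of $U$ in $T^2M$: for the 2-jet of a curve $F$, locally $x^i=F^i(t)$, one puts $x^i=F^i(0)$, $y^i=\frac{dF^i}{dt}(0)$, $z^i=\frac12\frac{d^2F^i}{dt^2}(0)$. The deformed 2-nd lift metric is the pseudo-Riemannian metric on $T^2M$ whose matrix in induced coordinates, ordered as $(x,y,z)$, is $$\overline g={}^{II}g+{}^0c=\begin{pmatrix} z^s\partial_s g_{ij}+\frac12 y^ty^s\partial_t\partial_s g_{ij}+c_{ij} & y^s\partial_s g_{ij} & g_{ij}\\ y^s\partial_s g_{ij}& g_{ij}&0\\ g_{ij}&0&0\end{pmatrix},\qquad \partial_i=\frac{\partial}{\partial x^i}.$$ The natural integrable nilpotent structure $\widehat\gamma$ is the $(1,1)$-tensor field on $T^2M$ with components, in induced coordinates, $\widehat\gamma=\begin{pmatrix}0&0&0\\ I&0&0\\0&I&0\end{pmatrix}$ ($I$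 the $n\times n$ unit matrix), i.e. $\widehat\gamma(\partial/\partial x^i)=\partial/\partial y^i$, $\widehat\gamma(\partial/\partial y^i)=\partial/\partial z^i$, $\widehat\gamma(\partial/\partial z^i)=0$. A nilpotent structure on a manifold $N$ is a $(1,1)$-tensor field $\gamma\ne0$ with $\gamma^3=0$. A $B$-metric (pure metric) with respect to $\gamma$ is a pseudo-Riemannian metric $h$ with $h(\gamma X,Y)=h(X,\gamma Y)$ for all vector fields $X,Y$. A plural-holomorphic $B$-manifold is a triple $(N,\gamma,h)$ of a smooth manifold $N$, a nilpotent structure $\gamma$ and a $B$-metric $h$ such that $\Phi_\gamma h=0$, where $\Phi_\gamma$ is the Tachibana operator $$(\Phi_\gamma h)(X,Y,Z)=(\gamma X)(h(Y,Z))-X(h(\gamma Y,Z))+h((L_Y\gamma)X,Z)+h(Y,(L_Z\gamma)X),$$ $L$ denoting Lie derivative. *)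

(* Defs.v *)
From HB Require Import structures.
From mathcomp Require Import all_boot all_order all_algebra.
From mathcomp Require Import all_classical all_reals all_analysis.
Set Implicit Arguments.
Unset Strict Implicit.
Unset Printing Implicit Defensive.
Import Order.TTheory GRing.Theory Num.Theory.
Import numFieldNormedType.Exports.
Local Open Scope classical_set_scope.
Local Open Scope ring_scope.

(* C^infinity on an open set U: every iterated directional derivative of f is
   (Frechet) differentiable, hence continuous, at every point of U. *)
Definition smooth_on (R : realType) (V W : normedModType R)
    (U : set V) (f : V -> W) : Prop :=
  forall (vs : seq V) (x : V), U x ->
    differentiable (foldr (fun v h => fun y => 'D_v h y) f vs) x.

(* Points of R^n are column vectors. The map of a chart is a total function
   on M, relevant on the domain of the chart only. *)
Record atlas (R : realType) (n : nat) (M : Type) := Atlas {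
  chart_index : Type;
  cdom : chart_index -> set M;
  cmap : chart_index -> M -> 'cV[R]_n }.

Section Atlas.
Context {R : realType} {n : nat} {M : Type} (A : atlas R n M).
Implicit Types (a b : chart_index A).

Definition cimage a : set 'cV[R]_n := cmap a @` cdom a.

Definition coverlap a b : set 'cV[R]_n := cmap a @` (cdom a `&` cdom b).

(* cmap b \o (cmap a)^-1 on coverlap a b, and 0 elsewhere *)
Definition ctransition a b (u : 'cV[R]_n) : 'cV[R]_n :=
  xget 0 (cmap b @` [set p | [/\ cdom a p, cdom b p & cmap a p = u]]).

End Atlas.

(* The atlas is not assumed to be maximal. *)
Record smooth_manifold (R : realType) (n : nat) (M : topologicalType)
    (A : atlas R n M) : Prop := SmoothManifold {
  manifold_hausdorff : hausdorff_space M;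
  manifold_second_countable : @second_countable M;
  chart_cover : forall p : M, exists a : chart_index A, cdom a p;
  chart_open_dom : forall a : chart_index A, open (cdom a);
  chart_inj : forall (a : chart_index A) (p q : M),
    cdom a p -> cdom a q -> cmap a p = cmap a q -> p = q;
  chart_continuous : forall (a : chart_index A) (p : M),
    cdom a p -> {for p, continuous (cmap a)};
  chart_open_map : forall (a : chart_index A) (O : set M),
    open O -> O `<=` cdom a -> open (cmap a @` O);
  chart_smooth : forall a b : chart_index A,
    smooth_on (coverlap a b) (ctransition a b) }.

(* A tensor field is the family of its local components in the charts of the
   atlas, as functions of the coordinates, related by the transformation law
   on overlaps; the values outside the image of a chart are irrelevant. The
   Jacobian matrix of the coordinate change phi is used through
   'D_v phi u = J *m v. *)
Section TensorFields.
Context {R : realType} {n : nat} {M : Type} (A : atlas R n M).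

Definition vec_components := chart_index A -> 'cV[R]_n -> 'cV[R]_n.
Definition mx_components := chart_index A -> 'cV[R]_n -> 'M[R]_n.

Definition bilin (h : 'M[R]_n) (v w : 'cV[R]_n) : R := (v^T *m h *m w) 0 0.

Definition vector_field (X : vec_components) : Prop :=
  (forall a, smooth_on (cimage a) (X a)) /\
  forall a b u, coverlap a b u ->
    X b (ctransition a b u) = 'D_(X a u) (ctransition a b) u.

(* (h a u) i j = h_ij *)
Definition tensor02 (h : mx_components) : Prop :=
  (forall a, smooth_on (cimage a) (h a)) /\
  forall a b u, coverlap a b u -> forall v w : 'cV[R]_n,
    bilin (h a u) v w =
    bilin (h b (ctransition a b u))
          ('D_v (ctransition a b) u) ('D_w (ctransition a b) u).

(* (f a u) i j = f^i_j, so that the field maps X to f a u *m X a u *)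
Definition tensor11 (f : mx_components) : Prop :=
  (forall a, smooth_on (cimage a) (f a)) /\
  forall a b u, coverlap a b u -> forall v : 'cV[R]_n,
    f b (ctransition a b u) *m 'D_v (ctransition a b) u =
    'D_(f a u *m v) (ctransition a b) u.

Definition symmetric_tensor02 (h : mx_components) : Prop :=
  tensor02 h /\ forall a u, cimage a u -> (h a u)^T = h a u.

Definition pseudo_riemannian (h : mx_components) : Prop :=
  symmetric_tensor02 h /\
  forall a u, cimage a u ->
    forall v, (forall w, bilin (h a u) v w = 0) -> v = 0.

Definition nilpotent_structure (f : mx_components) : Prop :=
  [/\ tensor11 f,
      (exists a u, cimage a u /\ f a u <> 0) &
      forall a u, cimage a u -> f a u *m f a u *m f a u = 0].

Definition tapply (f : mx_components) (X : vec_components) : vec_components :=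
  fun a u => f a u *m X a u.

Definition pairing (h : mx_components) (X Y : vec_components) :
    chart_index A -> 'cV[R]_n -> R :=
  fun a u => bilin (h a u) (X a u) (Y a u).

Definition vderive (X : vec_components) (f : chart_index A -> 'cV[R]_n -> R) :
    chart_index A -> 'cV[R]_n -> R :=
  fun a u => 'D_(X a u) (f a) u.

Definition lie_bracket (X Y : vec_components) : vec_components :=
  fun a u => 'D_(X a u) (Y a) u - 'D_(Y a u) (X a) u.

(* (L_Y f) X = [Y, f X] - f [Y, X] *)
Definition lie_tensor11 (Y : vec_components) (f : mx_components)
    (X : vec_components) : vec_components :=
  fun a u => lie_bracket Y (tapply f X) a u - tapply f (lie_bracket Y X) a u.

Definition B_metric (f h : mx_components) : Prop :=
  pseudo_riemannian h /\
  forall X Y, vector_field X -> vector_field Y ->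
    forall a u, cimage a u ->
      pairing h (tapply f X) Y a u = pairing h X (tapply f Y) a u.

Definition tachibana (f h : mx_components) (X Y Z : vec_components) :
    chart_index A -> 'cV[R]_n -> R :=
  fun a u =>
    vderive (tapply f X) (pairing h Y Z) a u
    - vderive X (pairing h (tapply f Y) Z) a u
    + pairing h (lie_tensor11 Y f X) Z a u
    + pairing h Y (lie_tensor11 Z f X) a u.

End TensorFields.

Definition plural_holomorphic_B_manifold (R : realType) (n : nat)
    (N : topologicalType) (A : atlas R n N) (f h : mx_components A) : Prop :=
  [/\ smooth_manifold A,
      nilpotent_structure f,
      B_metric f h &
      forall X Y Z : vec_components A,
        vector_field X -> vector_field Y -> vector_field Z ->
        forall a u, cimage a u -> tachibana f h X Y Z a u = 0].

Section SecondOrderTangentBundle.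
Context {R : realType} {n : nat} {M : topologicalType} (A : atlas R n M).

Definition smooth_curve (F : R -> M) : Prop :=
  continuous F /\
  forall a : chart_index A, smooth_on (F @^-1` cdom a) (cmap a \o F).

Definition same_2jet (F G : R -> M) : Prop :=
  F 0 = G 0 /\
  forall a : chart_index A, cdom a (F 0) ->
    derive1 (cmap a \o F) 0 = derive1 (cmap a \o G) 0 /\
    derive1n 2 (cmap a \o F) 0 = derive1n 2 (cmap a \o G) 0.

Definition jet2_class (F : R -> M) : set (R -> M) :=
  [set G | smooth_curve G /\ same_2jet F G].

Definition jet2 : Type :=
  {J : set (R -> M) | exists2 F, smooth_curve F & J = jet2_class F}.

Definition jet2_rep (p : jet2) : R -> M := s2val (cid2 (svalP p)).

Definition jet2_dom (a : chart_index A) : set jet2 :=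
  [set p | cdom a (jet2_rep p 0)].

Definition jet2_coord (a : chart_index A) (p : jet2) : 'cV[R]_(n + (n + n)) :=
  let f := cmap a \o jet2_rep p in
  col_mx (f 0) (col_mx (derive1 f 0) (2^-1 *: derive1n 2 f 0)).

HB.instance Definition _ := gen_eqMixin jet2.
HB.instance Definition _ := gen_choiceMixin jet2.

(* the topology making the induced charts homeomorphisms *)
HB.instance Definition _ := @isSubBaseTopological.Build jet2 (set jet2)
  [set O | exists (a : chart_index A) (W : set 'cV[R]_(n + (n + n))),
     open W /\ O = jet2_dom a `&` jet2_coord a @^-1` W] id.

Definition T2_atlas : atlas R (n + (n + n)) jet2 :=
  @Atlas R (n + (n + n)) jet2 (chart_index A) jet2_dom jet2_coord.

Definition xpart (w : 'cV[R]_(n + (n + n))) : 'cV[R]_n := usubmx w.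
Definition ypart (w : 'cV[R]_(n + (n + n))) : 'cV[R]_n := usubmx (dsubmx w).
Definition zpart (w : 'cV[R]_(n + (n + n))) : 'cV[R]_n := dsubmx (dsubmx w).

Definition pderiv (s : 'I_n) (f : 'cV[R]_n -> 'M[R]_n) : 'cV[R]_n -> 'M[R]_n :=
  fun x => 'D_(delta_mx s 0) f x.

Definition deformed_lift (g c : mx_components A) : mx_components T2_atlas :=
  fun a w =>
    let x := xpart w in let y := ypart w in let z := zpart w in
    let gxy := \sum_s y s 0 *: pderiv s (g a) x in
    let gxx := \sum_s z s 0 *: pderiv s (g a) x
             + 2^-1 *: (\sum_t \sum_s
                 (y t 0 * y s 0) *: pderiv t (pderiv s (g a)) x)
             + c a x in
    block_mx gxx             (row_mx gxy (g a x))
             (col_mx gxy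
                     (g a x)) (block_mx (g a x) 0
                                        0       0).

Definition gamma_hat : mx_components T2_atlas :=
  fun _ _ => block_mx 0             (row_mx 0 0)
                      (col_mx 1%:M
                              0)    (block_mx 0    0
                                              1%:M 0).

End SecondOrderTangentBundle.

Arguments gamma_hat {R n M} A _ _.

(* Main.v *)
From HB Require Import structures.
Require Import Defs.
From mathcomp Require Import all_boot all_order all_algebra finmap.
From mathcomp Require Import all_classical all_reals all_analysis.
From mathcomp Require Import ring lra.
Set Implicit Arguments.
Unset Strict Implicit.
Unset Printing Implicit Defensive.
Import Order.TTheory GRing.Theory Num.Theory.
Import numFieldNormedType.Exports.
Local Open Scope classical_set_scope.
Local Open Scope ring_scope.

(** A 2-jet of a curve is a curve x + y e + z e^2 with coefficients in R^n, over
the algebra R[e]/(e^3), and all the objects on the second-order tangent bundle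
T2M are the objects of M read over this algebra. A function f of x prolongs to
f(x + y e + z e^2) = f x + (lift1 f) e + (lift2 f) e^2 (lift1_curve,
lift2_curve); a coordinate change phi of M prolongs to the coordinate change
jlift phi = (phi, lift1 phi, lift2 phi) of T2M; gamma is the multiplication by
e; and the deformed lift sends two tangent vectors
v(e) = v0 + v1 e + v2 e^2 and w(e) to the coefficient of e^2 in
g(v(e), w(e)) + e^2 c(v(e), w(e)). The matrices of the differential of
jlift phi, of gamma and of the deformed lift have the shapes jac_lift_mx,
nil_mx and lift_mx.

This gives everything but the manifold structure. The Jacobian matrix of
jlift phi is the multiplication by the prolonged Jacobian matrix of phi
(derive_jlift), so that it commutes with gamma, and prolonging
g_a = J^T (g_b o phi) J by the Leibniz rule (lift_congruence) gives the
transformation law of the deformed lift (deformed_lift_transition). The lift is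
pure since multiplying either argument by e multiplies the result by e
(tr_nil_mx_lift_mx, lift_mx_nil_mx), and it is nondegenerate since its matrix
is block triangular with g on the antidiagonal (lift_mx_nondegenerate).

For a constant gamma and a pure metric h all derivatives of the three vector
fields cancel in the Tachibana operator, and what is left is
(D_(gamma X) h) (Y, Z) - (D_X h) (gamma Y, Z) (tachibana_const). It vanishes
because prolonged functions are differentiable over the algebra:
D_(gamma v) f = e D_v f, that is, D_(gamma v) lift2 f = D_v lift1 f and
D_(gamma v) lift1 f = D_v f. This is read off from the formulas derive_lift1
and derive_lift2, which rest on the symmetry of second derivatives
(derive_derive_comm). The term c depends on x only and occurs in the
coefficient of e^2 only, where D_(gamma v) annihilates it.

That T2M is a manifold is smooth_manifold_T2. The point that needs an argument
is that the induced charts have open images, i.e. that every (x, y, z) is the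
2-jet of a curve defined on the whole line: x + s y + s^2 z is such a curve if
s = d sin(t/d), which agrees with t to second order at 0 and is small with d
(jet2_coord_surj). *)

(** * Differentiability and directional derivatives *)

Section Differentiability.
Context {R : realType}.
Implicit Types (V W : normedModType R).

Lemma near_eq_differentiable V W (f g : V -> W) (a : V) :
  {near a, f =1 g} -> differentiable f a -> differentiable g a.
Proof.
move=> fg df.
have shg : g \o shift a = cst (g a) + 'd f a +o_ 0 id.
  have /diff_locally/eqaddoP hf := df.
  apply/eqaddoP => e e0; have := hf e e0; apply: filter_app.
  have : \forall x \near (0 : V), f (x + a) = g (x + a).
    by move: fg; rewrite (near_shift 0) /= subr0.
  apply: filter_app; near=> x => /= fgx.
  have fga : f a = g a by apply: (nbhs_singleton fg).
  by rewrite !fctE /= fgx fga.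
have dfc : continuous ('d f a) by exact: diff_continuous.
apply/diff_locallyP.
by rewrite (diff_unique dfc shg).
Unshelve. all: by end_near. Qed.

Lemma open_eq_near V W (U : set V) (f g : V -> W) a :
  open U -> U a -> (forall x, U x -> f x = g x) -> \near a, f a = g a.
Proof.
move=> oU Ua fg; have : nbhs a U by exact: open_nbhs_nbhs.
by apply: filterS.
Qed.

Lemma differentiable_mxP V p q (M : V -> 'M[R]_(p, q)) x :
  differentiable M x <-> forall i j, differentiable (fun y => M y i j) x.
Proof.
split=> [dM i j|dM].
  apply: (@differentiable_comp _ _ _ _ M (fun N : 'M[R]_(p, q) => N i j)) => //.
  exact: differentiable_coord.
rewrite (_ : M = \sum_i \sum_j (fun y => M y i j *: delta_mx i j)); last first.
  apply/funext => y; rewrite fct_sumE [LHS]matrix_sum_delta.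
  by apply: eq_bigr => i _; rewrite fct_sumE.
apply: differentiable_sum => i; apply: differentiable_sum => j.
exact: differentiableZl.
Qed.

Lemma derive_mxE V p q (M : V -> 'M[R]_(p, q)) x v i j :
  differentiable M x -> 'D_v M x i j = 'D_v (fun y => M y i j) x.
Proof. by move=> dM; rewrite derive_mx ?mxE//; exact: diff_derivable. Qed.

(** Both sides are limits of the same difference quotient, so that f may be
any function. *)
Lemma derive_linear_arg V V' W (l : {linear V -> V'}) (f : V' -> W) x v :
  'D_v (f \o l) x = 'D_(l v) f (l x).
Proof.
rewrite /derive; set d := (fun h : R => _); set d' := (fun h : R => _).
by suff -> : d = d' by []; apply/funext => h; rewrite /d /d' /= linearP.
Qed.

Lemma derive_coord n W (f : 'cV[R]_n -> W) x v : differentiable f x ->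
  'D_v f x = \sum_s v s 0 *: 'D_(delta_mx s 0) f x.
Proof.
move=> df; rewrite deriveE//.
have -> : v = \sum_s v s 0 *: delta_mx s 0.
  by rewrite [LHS]matrix_sum_delta; apply: eq_bigr => s _; rewrite big_ord1.
rewrite linear_sum; apply: eq_bigr => s _; rewrite linearZ deriveE//=.
congr (_ *: _); rewrite summxE (bigD1 s)//= !mxE !eqxx mulr1.
rewrite big1 ?addr0// => t ts.
by rewrite !mxE eq_sym (negbTE ts) mulr0.
Qed.

Lemma derive_comp V n W (g : V -> 'cV[R]_n) (f : 'cV[R]_n -> W) x v :
  differentiable g x -> differentiable f (g x) ->
  'D_v (f \o g) x = 'D_('D_v g x) f (g x).
Proof.
move=> dg df; rewrite [LHS]deriveE; last exact: differentiable_comp.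
by rewrite diff_comp //= !deriveE.
Qed.

End Differentiability.

Lemma mx_linear_differentiable (R : realType) p q (W : normedModType R)
    (l : {linear 'M[R]_(p, q) -> W}) M : differentiable l M.
Proof.
rewrite (_ : (l : _ -> _) =
    \sum_i \sum_j (fun N : 'M[R]_(p, q) => N i j *: l (delta_mx i j))).
  apply: differentiable_sum => i; apply: differentiable_sum => j.
  by apply: differentiableZl; exact: differentiable_coord.
apply/funext => N; rewrite fct_sumE [in LHS](matrix_sum_delta N) linear_sum.
apply: eq_bigr => i _; rewrite fct_sumE linear_sum.
by apply: eq_bigr => j _; rewrite linearZ.
Qed.

Section DeriveRules.
Context {R : realType} {V : normedModType R}.

Lemma derive_sum_fun m (W : normedModType R) (h : 'I_m -> V -> W) x v :
  (forall i, differentiable (h i) x) ->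
  'D_v (fun y => \sum_i h i y) x = \sum_i 'D_v (h i) x.
Proof.
move=> dh; rewrite -derive_sum; last by move=> i; exact: diff_derivable.
by congr ('D_v _ x); apply/funext => y; rewrite fct_sumE.
Qed.

Lemma derive_mul (f g : V -> R) x v : differentiable f x -> differentiable g x ->
  'D_v (fun y => f y * g y) x = 'D_v f x * g x + f x * 'D_v g x.
Proof.
move=> df dg; rewrite [LHS]deriveM; [|exact: diff_derivable..].
by rewrite addrC; congr (_ + _); exact: mulrC.
Qed.

Lemma differentiable_scale p q (a : V -> R) (M : V -> 'M[R]_(p, q)) x :
  differentiable a x -> differentiable M x ->
  differentiable (fun y => a y *: M y) x.
Proof.
move=> da dM; apply/differentiable_mxP => i j.
rewrite (_ : (fun y => _) = (fun y => a y * M y i j)).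
  by apply: differentiableM => //; move: i j; apply/differentiable_mxP.
by apply/funext => y; rewrite mxE.
Qed.

Lemma derive_scale p q (a : V -> R) (M : V -> 'M[R]_(p, q)) x v :
  differentiable a x -> differentiable M x ->
  'D_v (fun y => a y *: M y) x = 'D_v a x *: M x + a x *: 'D_v M x.
Proof.
move=> da dM.
have dMij i j : differentiable (fun y => M y i j) x.
  by move: i j; apply/differentiable_mxP.
have daM := differentiable_scale da dM.
apply/matrixP => i j; rewrite derive_mxE// !mxE derive_mxE//.
rewrite (_ : (fun y => _) = (fun y => a y * M y i j)); last first.
  by apply/funext => y; rewrite mxE.
by rewrite derive_mul.
Qed.

Lemma derive_mulmx p q r (M : V -> 'M[R]_(p, q)) (N : V -> 'M[R]_(q, r)) x v :
  differentiable M x -> differentiable N x ->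
  'D_v (fun y => M y *m N y) x = 'D_v M x *m N x + M x *m 'D_v N x.
Proof.
move=> dM dN.
have dMij i j : differentiable (fun y => M y i j) x.
  by move: i j; apply/differentiable_mxP.
have dNij i j : differentiable (fun y => N y i j) x.
  by move: i j; apply/differentiable_mxP.
have E i k : (fun y => (M y *m N y) i k) = (fun y => \sum_j M y i j * N y j k).
  by apply/funext => y; rewrite mxE.
have dMN : differentiable (fun y => M y *m N y) x.
  apply/differentiable_mxP => i k; rewrite E.
  rewrite (_ : (fun y => _) = \sum_j (fun y => M y i j * N y j k)).
    by apply: differentiable_sum => j; exact: differentiableM.
  by apply/funext => y; rewrite fct_sumE.
apply/matrixP => i k; rewrite derive_mxE// E derive_sum_fun; last first.
  by move=> j; exact: differentiableM.
rewrite !mxE -big_split/=; apply: eq_bigr => j _.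
by rewrite derive_mul// (derive_mxE v i j dM) (derive_mxE v j k dN).
Qed.

Lemma derive_linear_comp p q p' q' (l : {linear 'M[R]_(p, q) -> 'M[R]_(p', q')})
    (f : V -> 'M[R]_(p, q)) x v : differentiable f x ->
  'D_v (l \o f) x = l ('D_v f x).
Proof.
move=> df; have dl M : differentiable l M by exact: mx_linear_differentiable.
rewrite deriveE; last exact: differentiable_comp.
rewrite diff_comp //= deriveE// diff_lin// => M.
exact: differentiable_continuous.
Qed.

End DeriveRules.

(** * Smooth functions on an open set *)

Section Smoothness.
Context {R : realType}.
Implicit Types (V W : normedModType R) (k : nat).

(** The truncation of smooth_on at order k. Closure properties of smooth_on are
proved at each finite order: the derivative of a product or of a composite
function involves the functions themselves next to their derivatives, so that
only an induction on the order goes through. *)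
Fixpoint Cdiff k V W (U : set V) (f : V -> W) : Prop :=
  (forall x, U x -> differentiable f x) /\
  if k is k'.+1 then forall v, Cdiff k' U (fun x => 'D_v f x) else True.

Lemma Cdiff_differentiable k V W (U : set V) (f : V -> W) x :
  Cdiff k U f -> U x -> differentiable f x.
Proof. by case: k => [|k] [fU _]; exact: fU. Qed.

Lemma CdiffW k V W (U : set V) (f : V -> W) : Cdiff k.+1 U f -> Cdiff k U f.
Proof.
elim: k f => [|k IH] f [df ddf]; first by split.
by split => // v; apply: IH.
Qed.

Lemma Cdiff_eq k V W (U : set V) (f g : V -> W) : open U ->
  (forall x, U x -> f x = g x) -> Cdiff k U f -> Cdiff k U g.
Proof.
move=> oU; elim: k f g => [|k IH] f g fg [df ddf].
  split => // x Ux; apply: near_eq_differentiable (df x Ux).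
  exact: open_eq_near fg.
split=> [x Ux|v].
  apply: near_eq_differentiable (df x Ux); exact: open_eq_near fg.
apply: IH (ddf v) => x Ux; apply: near_eq_derive; exact: open_eq_near fg.
Qed.

Lemma smooth_onP V W (U : set V) (f : V -> W) :
  smooth_on U f <-> forall k, Cdiff k U f.
Proof.
split=> [sf k|Cf vs].
  elim: k f sf => [|k IH] f sf.
    by split => // x; exact: (sf [::]).
  split=> [x|v]; first exact: (sf [::]).
  apply: IH => vs x Ux.
  by have := sf (rcons vs v) x Ux; rewrite -cats1 foldr_cat.
(* the last direction of the list is the one differentiated first *)
elim/last_ind: vs f Cf => [|vs v IH] f Cf x Ux /=.
  exact: Cdiff_differentiable (Cf 0%N) Ux.
rewrite -cats1 foldr_cat /=; apply: IH => // k.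
by have [_] := Cf k.+1; apply.
Qed.

Lemma smooth_on_differentiable V W (U : set V) (f : V -> W) x :
  smooth_on U f -> U x -> differentiable f x.
Proof. by move=> /(_ [::] x). Qed.

Lemma smooth_on_derive V W (U : set V) (f : V -> W) v :
  smooth_on U f -> smooth_on U (fun x => 'D_v f x).
Proof.
move=> /smooth_onP Cf; apply/smooth_onP => k.
by have [_] := Cf k.+1; exact.
Qed.

Lemma smooth_on_eq V W (U : set V) (f g : V -> W) : open U ->
  (forall x, U x -> f x = g x) -> smooth_on U f -> smooth_on U g.
Proof.
move=> oU fg /smooth_onP Cf; apply/smooth_onP => k; exact: Cdiff_eq fg (Cf k).
Qed.

Lemma smooth_on_sub V W (U U' : set V) (f : V -> W) :
  U' `<=` U -> smooth_on U f -> smooth_on U' f.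
Proof. by move=> sU sf vs x /sU; exact: sf. Qed.

Lemma Cdiff_cst k V W (U : set V) (c : W) : Cdiff k U (cst c : V -> W).
Proof.
elim: k c => [|k IH] c; split => //.
move=> v; rewrite (_ : (fun x => _) = cst 0 :> (V -> W)); last first.
  by apply/funext => x; rewrite derive_cst.
exact: IH.
Qed.

Lemma CdiffD k V W (U : set V) (f g : V -> W) : open U ->
  Cdiff k U f -> Cdiff k U g -> Cdiff k U (fun x => f x + g x).
Proof.
move=> oU; elim: k f g => [|k IH] f g [df ddf] [dg ddg].
  by split=> // x Ux; apply: differentiableD; [exact: df|exact: dg].
split=> [x Ux|v]; first by apply: differentiableD; [exact: df|exact: dg].
apply: Cdiff_eq (IH _ _ (ddf v) (ddg v)) => // x Ux.
by rewrite [RHS]deriveD//; apply: diff_derivable; [exact: df|exact: dg].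
Qed.

Lemma Cdiff_sum k V W (U : set V) (I : Type) (r : seq I) (f : I -> V -> W) :
  open U -> (forall i, Cdiff k U (f i)) ->
  Cdiff k U (fun x => \sum_(i <- r) f i x).
Proof.
move=> oU Cf; elim: r => [|i r IH].
  by under [X in Cdiff _ _ X]funext do rewrite big_nil; exact: Cdiff_cst.
by under [X in Cdiff _ _ X]funext do rewrite big_cons; exact: CdiffD.
Qed.

Lemma CdiffM k V (U : set V) (f g : V -> R) : open U ->
  Cdiff k U f -> Cdiff k U g -> Cdiff k U (fun x => f x * g x).
Proof.
move=> oU; elim: k f g => [|k IH] f g Cf Cg.
  split=> // x Ux; apply: differentiableM.
    exact: Cdiff_differentiable Cf Ux.
  exact: Cdiff_differentiable Cg Ux.
have [df ddf] := Cf; have [dg ddg] := Cg.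
split=> [x Ux|v]; first by apply: differentiableM; [exact: df|exact: dg].
have CD := CdiffD oU (IH _ _ (CdiffW Cf) (ddg v)) (IH _ _ (CdiffW Cg) (ddf v)).
apply: Cdiff_eq CD => // x Ux.
by rewrite [RHS]deriveM//; apply: diff_derivable; [exact: df|exact: dg].
Qed.

Lemma Cdiff_mxP k V p q (U : set V) (M : V -> 'M[R]_(p, q)) : open U ->
  Cdiff k U M <-> forall i j, Cdiff k U (fun x => M x i j).
Proof.
move=> oU; elim: k M => [|k IH] M.
  split=> [[dM _] i j|CM]; split => // x Ux.
    by move: i j; apply/differentiable_mxP/dM.
  by apply/differentiable_mxP => i j; exact: Cdiff_differentiable (CM i j) Ux.
split=> [[dM ddM] i j|CM].
  split=> [x Ux|v]; first by move: i j; apply/differentiable_mxP/dM.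
  have /IH/(_ i j) := ddM v; apply: Cdiff_eq => // x Ux.
  by rewrite derive_mxE//; exact: dM.
have dM x : U x -> differentiable M x.
  move=> Ux; apply/differentiable_mxP => i j.
  exact: Cdiff_differentiable (CM i j) Ux.
split=> // v; apply/IH => i j; have [_ /(_ v)] := CM i j.
by apply: Cdiff_eq => // x Ux; rewrite derive_mxE//; exact: dM.
Qed.

Lemma CdiffZ k V p q (U : set V) (a : V -> R) (M : V -> 'M[R]_(p, q)) :
  open U -> Cdiff k U a -> Cdiff k U M -> Cdiff k U (fun x => a x *: M x).
Proof.
move=> oU Ca /(Cdiff_mxP _ _ oU) CM; apply/Cdiff_mxP => // i j.
by under [X in Cdiff _ _ X]funext do rewrite mxE; exact: CdiffM.
Qed.

(** The chain rule turns the derivative of the composite into a sum of products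
of D_v g with partial derivatives of f composed with g; the latter are covered
by the induction hypothesis. *)
Lemma Cdiff_comp k V n p q (O : set V) (U : set 'cV[R]_n) (g : V -> 'cV[R]_n)
    (f : 'cV[R]_n -> 'M[R]_(p, q)) : open O -> O `<=` g @^-1` U ->
  Cdiff k O g -> Cdiff k U f -> Cdiff k O (f \o g).
Proof.
move=> oO OU; elim: k f g OU => [|k IH] f g OU Cg Cf.
  split=> // x Ox; apply: differentiable_comp.
    exact: Cdiff_differentiable Cg Ox.
  exact: Cdiff_differentiable Cf (OU _ Ox).
have [dg ddg] := Cg; have [df ddf] := Cf.
split=> [x Ox|v].
  by apply: differentiable_comp; [exact: dg|exact/df/OU].
have ddfg s : Cdiff k O ((fun y => 'D_(delta_mx s 0) f y) \o g).
  exact: IH OU (CdiffW Cg) (ddf _).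
have ddgs s : Cdiff k O (fun x => 'D_v g x s 0).
  by have /(Cdiff_mxP _ _ oO)/(_ s 0) := ddg v.
have := Cdiff_sum (index_enum 'I_n) oO (fun s => CdiffZ oO (ddgs s) (ddfg s)).
apply: Cdiff_eq => // x Ox; rewrite derive_comp ?derive_coord//.
- exact/df/OU.
- exact: dg.
- exact/df/OU.
Qed.

Lemma smooth_on_cst V W (U : set V) (c : W) : smooth_on U (cst c : V -> W).
Proof. by apply/smooth_onP => k; exact: Cdiff_cst. Qed.

Lemma smooth_onD V W (U : set V) (f g : V -> W) : open U ->
  smooth_on U f -> smooth_on U g -> smooth_on U (fun x => f x + g x).
Proof.
by move=> oU /smooth_onP Cf /smooth_onP Cg; apply/smooth_onP => k; exact: CdiffD.
Qed.

Lemma smooth_on_sum V W (U : set V) (I : Type) (r : seq I) (f : I -> V -> W) :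
  open U -> (forall i, smooth_on U (f i)) ->
  smooth_on U (fun x => \sum_(i <- r) f i x).
Proof.
move=> oU Cf; apply/smooth_onP => k; apply: Cdiff_sum => // i.
by move: k; apply/smooth_onP.
Qed.

Lemma smooth_onM V (U : set V) (f g : V -> R) : open U ->
  smooth_on U f -> smooth_on U g -> smooth_on U (fun x => f x * g x).
Proof.
by move=> oU /smooth_onP Cf /smooth_onP Cg; apply/smooth_onP => k; exact: CdiffM.
Qed.

Lemma smooth_onZ V p q (U : set V) (a : V -> R) (M : V -> 'M[R]_(p, q)) :
  open U -> smooth_on U a -> smooth_on U M -> smooth_on U (fun x => a x *: M x).
Proof.
by move=> oU /smooth_onP Cf /smooth_onP Cg; apply/smooth_onP => k; exact: CdiffZ.
Qed.

Lemma smooth_on_comp V n p q (O : set V) (U : set 'cV[R]_n) (g : V -> 'cV[R]_n)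
    (f : 'cV[R]_n -> 'M[R]_(p, q)) : open O -> O `<=` g @^-1` U ->
  smooth_on O g -> smooth_on U f -> smooth_on O (f \o g).
Proof.
move=> oO OU /smooth_onP Cg /smooth_onP Cf; apply/smooth_onP => k.
exact: Cdiff_comp OU _ _.
Qed.

Lemma smooth_on_mxP V p q (U : set V) (M : V -> 'M[R]_(p, q)) : open U ->
  smooth_on U M <-> forall i j, smooth_on U (fun x => M x i j).
Proof.
move=> oU; split=> [/smooth_onP CM i j|CM].
  by apply/smooth_onP => k; move: i j; apply/Cdiff_mxP.
apply/smooth_onP => k; apply/Cdiff_mxP => // i j.
by move: k; apply/smooth_onP.
Qed.

Lemma smooth_on_linear V p q p' q' (U : set V)
    (l : {linear 'M[R]_(p, q) -> 'M[R]_(p', q')}) (M : V -> 'M[R]_(p, q)) :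
  open U -> smooth_on U M -> smooth_on U (l \o M).
Proof.
move=> oU sM.
rewrite (_ : l \o M = fun x => \sum_i \sum_j M x i j *: l (delta_mx i j)).
  apply: smooth_on_sum => // i; apply: smooth_on_sum => // j.
  apply: smooth_onZ => //; last exact: smooth_on_cst.
  by move: i j; apply/smooth_on_mxP.
apply/funext => x /=; rewrite [in LHS](matrix_sum_delta (M x)) linear_sum.
apply: eq_bigr => i _; rewrite linear_sum.
by apply: eq_bigr => j _; rewrite linearZ.
Qed.

Lemma smooth_on_id V (U : set V) : smooth_on U (@id V).
Proof.
apply/smooth_onP => k; case: k => [|k]; split=> //; move=> v.
rewrite (_ : (fun x => _) = cst v); first exact: Cdiff_cst.
by apply/funext => x; rewrite derive_id.
Qed.

End Smoothness.

Section SmoothMulmx.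
Context {R : realType} {V : normedModType R}.
Lemma smooth_on_mulmx p q r (U : set V) (M : V -> 'M[R]_(p, q))
    (N : V -> 'M[R]_(q, r)) : open U ->
  smooth_on U M -> smooth_on U N -> smooth_on U (fun x => M x *m N x).
Proof.
move=> oU /(smooth_on_mxP _ oU) sM /(smooth_on_mxP _ oU) sN.
apply/smooth_on_mxP => // i k.
under [X in smooth_on _ X]funext do rewrite mxE.
by apply: smooth_on_sum => // j; exact: smooth_onM.
Qed.
End SmoothMulmx.

Lemma smooth_on_col_mx (R : realType) (V : normedModType R) m1 m2 p (U : set V)
    (f : V -> 'M[R]_(m1, p)) (g : V -> 'M[R]_(m2, p)) : open U ->
  smooth_on U f -> smooth_on U g -> smooth_on U (fun x => col_mx (f x) (g x)).
Proof.
move=> oU /(smooth_on_mxP _ oU) sf /(smooth_on_mxP _ oU) sg.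
apply/smooth_on_mxP => // i j; case: (splitP i) => [i1|i2] iE.
  rewrite (_ : (fun x => _) = (fun x => f x i1 j)); first exact: sf.
  apply/funext => x; rewrite (_ : i = lshift m2 i1); first exact: col_mxEu.
  exact: val_inj.
rewrite (_ : (fun x => _) = (fun x => g x i2 j)); first exact: sg.
apply/funext => x; rewrite (_ : i = rshift m1 i2); first exact: col_mxEd.
exact: val_inj.
Qed.

Lemma smooth_on_row_mx (R : realType) (V : normedModType R) m p1 p2 (U : set V)
    (f : V -> 'M[R]_(m, p1)) (g : V -> 'M[R]_(m, p2)) : open U ->
  smooth_on U f -> smooth_on U g -> smooth_on U (fun x => row_mx (f x) (g x)).
Proof.
move=> oU /(smooth_on_mxP _ oU) sf /(smooth_on_mxP _ oU) sg.
apply/smooth_on_mxP => // i j; case: (splitP j) => [j1|j2] jE.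
  rewrite (_ : (fun x => _) = (fun x => f x i j1)); first exact: sf.
  apply/funext => x; rewrite (_ : j = lshift p2 j1); first exact: row_mxEl.
  exact: val_inj.
rewrite (_ : (fun x => _) = (fun x => g x i j2)); first exact: sg.
apply/funext => x; rewrite (_ : j = rshift p1 j2); first exact: row_mxEr.
exact: val_inj.
Qed.

Section DeriveBlocks.
Context {R : realType} {V : normedModType R}.

Lemma derive_col_mx m1 m2 p (f : V -> 'M[R]_(m1, p)) (g : V -> 'M[R]_(m2, p))
    (U : set V) x v : open U -> smooth_on U f -> smooth_on U g -> U x ->
  'D_v (fun y => col_mx (f y) (g y)) x = col_mx ('D_v f x) ('D_v g x).
Proof.
move=> oU sf sg Ux.
have df := smooth_on_differentiable sf Ux.
have dg := smooth_on_differentiable sg Ux.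
have dfg := smooth_on_differentiable (smooth_on_col_mx oU sf sg) Ux.
apply/matrixP => i j; rewrite (derive_mxE v i j dfg).
case: (splitP i) => [i1|i2] iE.
  have -> : i = lshift m2 i1 by exact: val_inj.
  rewrite col_mxEu (derive_mxE v i1 j df).
  by under eq_fun do rewrite col_mxEu.
have -> : i = rshift m1 i2 by exact: val_inj.
rewrite col_mxEd (derive_mxE v i2 j dg).
by under eq_fun do rewrite col_mxEd.
Qed.

Lemma derive_row_mx m p1 p2 (f : V -> 'M[R]_(m, p1)) (g : V -> 'M[R]_(m, p2))
    (U : set V) x v : open U -> smooth_on U f -> smooth_on U g -> U x ->
  'D_v (fun y => row_mx (f y) (g y)) x = row_mx ('D_v f x) ('D_v g x).
Proof.
move=> oU sf sg Ux.
have df := smooth_on_differentiable sf Ux.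
have dg := smooth_on_differentiable sg Ux.
have dfg := smooth_on_differentiable (smooth_on_row_mx oU sf sg) Ux.
apply/matrixP => i j; rewrite (derive_mxE v i j dfg).
case: (splitP j) => [j1|j2] jE.
  have -> : j = lshift p2 j1 by exact: val_inj.
  rewrite row_mxEl (derive_mxE v i j1 df).
  by under eq_fun do rewrite row_mxEl.
have -> : j = rshift p1 j2 by exact: val_inj.
rewrite row_mxEr (derive_mxE v i j2 dg).
by under eq_fun do rewrite row_mxEr.
Qed.

End DeriveBlocks.

(** * Symmetry of second derivatives *)

Section Schwarz.
Context {R : realType} {V : normedModType R}.
Implicit Types (f : V -> R) (x v w : V).

Lemma is_derive_line f x v (s : R) : differentiable f (x + s *: v) ->
  is_derive s 1 (fun t : R => f (x + t *: v)) ('D_v f (x + s *: v)).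
Proof.
move=> df.
have dl : differentiable (fun t : R => x + t *: v) s.
  by apply: differentiableD => //; exact: differentiableZl.
split; first by apply: diff_derivable; exact: (differentiable_comp dl df).
rewrite /derive; congr (lim (_ @ 0^')); apply/funext => h /=.
by rewrite [h *: 1]mulr1 scalerDl addrCA.
Qed.

(** The second difference of f along v and w is the increment over [0, h] of the
function phi below; the mean value theorem for phi, then for D_v f along w,
gives an intermediate point. *)
Lemma second_difference f (U : set V) x v w (h : R) :
  smooth_on U f -> 0 < h ->
  (forall s t : R, 0 <= s <= h -> 0 <= t <= h -> U (x + s *: v + t *: w)) ->
  exists s t : R, [/\ 0 <= s <= h, 0 <= t <= h &
    f (x + h *: v + h *: w) - f (x + h *: v) - f (x + h *: w) + f x =
    h * (h * 'D_w (fun y => 'D_v f y) (x + s *: v + t *: w))].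
Proof.
move=> sf h0 Uh.
have hh : 0 <= h <= h by rewrite lexx ltW.
have h00 : 0 <= (0 : R) <= h by rewrite lexx ltW.
pose phi := fun s : R => f (x + h *: w + s *: v) - f (x + s *: v).
pose dphi := fun s : R => 'D_v f (x + h *: w + s *: v) - 'D_v f (x + s *: v).
have dphiP s : 0 <= s <= h -> is_derive s 1 phi (dphi s).
  move=> sh; apply: is_deriveB; apply: is_derive_line.
    by apply: (smooth_on_differentiable sf); rewrite addrAC; exact: Uh.
  apply: (smooth_on_differentiable sf).
  by rewrite -[x + _]addr0 -(scale0r w); exact: Uh.
have inI (s : R) : s \in `]0, h[ -> 0 <= s <= h.
  by rewrite in_itv /= => /andP[? ?]; rewrite !ltW.
have cont (g dg : R -> R) : (forall s, 0 <= s <= h -> is_derive s 1 g (dg s)) ->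
    {within `[0, h], continuous g}.
  move=> dgP; apply: derivable_within_continuous => s.
  by rewrite in_itv /= => /dgP[].
have [s /inI sh] := MVT h0 (fun s si => dphiP s (inI s si)) (cont _ _ dphiP).
rewrite subr0 => phiE.
have dpsiP t : 0 <= t <= h -> is_derive t 1
    (fun t : R => 'D_v f (x + s *: v + t *: w))
    ('D_w (fun y => 'D_v f y) (x + s *: v + t *: w)).
  move=> th; apply: (@is_derive_line (fun y => 'D_v f y)).
  by apply: (smooth_on_differentiable (smooth_on_derive v sf)); exact: Uh.
have [t /inI th] := MVT h0 (fun t ti => dpsiP t (inI t ti)) (cont _ _ dpsiP).
rewrite subr0 => psiE.
exists s, t; split => //.
transitivity (phi h - phi 0).
  by rewrite /phi !scale0r !addr0 [x + h *: w + _]addrAC; ring.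
rewrite phiE mulrC [in RHS]mulrC mulrC; congr (_ * _).
rewrite [RHS]mulrC -psiE /dphi scale0r addr0.
by rewrite [x + _ + _]addrAC.
Qed.

Lemma near_plane x v w (P : set V) : nbhs x P -> exists2 h : R, 0 < h &
  forall s t : R, 0 <= s <= h -> 0 <= t <= h -> P (x + s *: v + t *: w).
Proof.
move=> /nbhs_ballP[e /= e0 xeP].
have d0 : 0 < `|v| + `|w| + 1 by rewrite ltr_wpDl ?addr_ge0.
exists (e / 2 / (`|v| + `|w| + 1)); first by rewrite !divr_gt0.
move=> s t /andP[s0 sh] /andP[t0 th]; apply: xeP.
rewrite -ball_normE /ball_/= -addrA opprD addrA subrr sub0r normrN.
apply: le_lt_trans (ler_normD _ _) _; rewrite !normrZ !ger0_norm//.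
apply: (@le_lt_trans _ _ (e / 2)); last lra.
apply: le_trans (_ : e / 2 / (`|v| + `|w| + 1) * (`|v| + `|w| + 1) <= _).
  rewrite !mulrDr mulr1 -[leLHS]addr0 !lerD ?ler_wpM2r//.
  by rewrite ltW// !divr_gt0.
by rewrite divfK// gt_eqF.
Qed.

Lemma dist_lt_half (a b m r : R) :
  `|a - m| < r / 2 -> `|b - m| < r / 2 -> `|a - b| < r.
Proof.
rewrite (distrC b m) => am mb; rewrite -[a - b](subrKA m) [r]splitr.
exact: le_lt_trans (ler_normD _ _) (ltrD am mb).
Qed.

(** The second difference is symmetric in v and w, so it is h^2 times a value
of D_w D_v f and h^2 times a value of D_v D_w f, both at points that tend to
x with h; if the two derivatives differed at x, continuity would separate
these values. *)
Lemma derive_derive_comm f (U : set V) x v w : open U -> smooth_on U f -> U x ->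
  'D_v (fun y => 'D_w f y) x = 'D_w (fun y => 'D_v f y) x.
Proof.
move=> oU sf Ux; apply/eqP/negPn/negP => ne.
set a := 'D_v _ x in ne; set b := 'D_w _ x in ne.
have e0 : 0 < `|a - b| / 2 by rewrite divr_gt0// normr_gt0 subr_eq0.
have nearU : nbhs x U by exact: open_nbhs_nbhs.
have near2 v' w' : \forall y \near x,
    `|'D_v' (fun y => 'D_w' f y) x - 'D_v' (fun y => 'D_w' f y) y| < `|a - b| / 2.
  have /differentiable_continuous := smooth_on_differentiable
    (smooth_on_derive v' (smooth_on_derive w' sf)) Ux.
  by move=> /cvgrPdist_lt; exact.
have [h h0 hP] :=
  near_plane v w (filterI nearU (filterI (near2 v w) (near2 w v))).
have [|s [t [sh th E1]]] := @second_difference f U x v w h sf h0.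
  by move=> s t sh th; have [] := hP s t sh th.
have [|t' [s' [th' sh' E2]]] := @second_difference f U x w v h sf h0.
  by move=> s' t' sh' th'; rewrite addrAC; have [] := hP t' s' th' sh'.
have {E1 E2} E : 'D_w (fun y => 'D_v f y) (x + s *: v + t *: w) =
    'D_v (fun y => 'D_w f y) (x + s' *: v + t' *: w).
  apply: (mulfI (lt0r_neq0 h0)); apply: (mulfI (lt0r_neq0 h0)).
  rewrite [x + _ + t' *: w]addrAC; apply: etrans (etrans (esym E1) _) E2.
  rewrite [x + h *: w + _]addrAC; ring.
have [_ [_ hb]] := hP s t sh th; have [_ [ha _]] := hP s' t' sh' th'.
rewrite E in hb.
by have := dist_lt_half ha hb; rewrite ltxx.
Qed.

End Schwarz.

Lemma derive_derive_comm_mx {R : realType} (V : normedModType R) p q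
  (f : V -> 'M[R]_(p, q)) (U : set V) x v w : open U -> smooth_on U f -> U x ->
  'D_v (fun y => 'D_w f y) x = 'D_w (fun y => 'D_v f y) x.
Proof.
move=> oU sf Ux; apply/matrixP => i j.
have sfij : smooth_on U (fun y => f y i j) by move: i j; apply/smooth_on_mxP.
have E v' w' : 'D_v' (fun y => 'D_w' f y) x i j =
    'D_v' (fun y => 'D_w' (fun z => f z i j) y) x.
  rewrite derive_mxE; last first.
    exact: smooth_on_differentiable (smooth_on_derive _ sf) Ux.
  apply: near_eq_derive; apply: open_eq_near oU Ux _ => y Uy.
  by rewrite derive_mxE//; exact: smooth_on_differentiable sf Uy.
apply: etrans (E v w) (etrans _ (esym (E w v))).
exact: derive_derive_comm oU sfij Ux.
Qed.

(** * First and second lifts of a function *)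

Lemma big_scaleD (K : pzRingType) (L : lmodType K) (I : finType)
    (a b c : I -> L) (y : I -> K) :
  \sum_i (a i + y i *: (b i + c i)) =
  \sum_i a i + (\sum_i y i *: b i + \sum_i y i *: c i).
Proof.
by rewrite -!big_split; apply: eq_bigr => i _; rewrite scalerDr.
Qed.

Lemma half_double (K : numFieldType) (L : lmodType K) (a b c : L) :
  a = c -> 2^-1 *: (a + (b + c)) = 2^-1 *: b + c.
Proof.
move=> ->; rewrite addrCA scalerDr -mulr2n -[c *+ 2]scaler_nat scalerA.
by rewrite mulVf ?scale1r// pnatr_eq0.
Qed.

Section Lift.
Context {R : realType} {n : nat}.
Local Notation T2 := 'cV[R]_(n + (n + n)).
Implicit Types (w v : T2) (U : set 'cV[R]_n).

Lemma xpart_is_linear : linear (@xpart R n). Proof. exact: linearP. Qed.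
HB.instance Definition _ :=
  GRing.isLinear.Build _ _ _ _ (@xpart R n) xpart_is_linear.
Lemma ypart_is_linear : linear (@ypart R n).
Proof. by move=> a u w; rewrite /ypart !linearP. Qed.
HB.instance Definition _ :=
  GRing.isLinear.Build _ _ _ _ (@ypart R n) ypart_is_linear.
Lemma zpart_is_linear : linear (@zpart R n).
Proof. by move=> a u w; rewrite /zpart !linearP. Qed.
HB.instance Definition _ :=
  GRing.isLinear.Build _ _ _ _ (@zpart R n) zpart_is_linear.

Definition partial p q (s : 'I_n) (f : 'cV[R]_n -> 'M[R]_(p, q)) :
    'cV[R]_n -> 'M[R]_(p, q) := fun x => 'D_(delta_mx s 0) f x.

(** The coefficients of t and t^2 in the Taylor expansion of
f (x + t y + t^2 z), where w = (x, y, z). For f = g these are the blocks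
of the second lift of a metric, and for f a coordinate change they are the
last two components of the induced coordinate change. *)
Definition lift1 p q (f : 'cV[R]_n -> 'M[R]_(p, q)) w : 'M[R]_(p, q) :=
  \sum_s ypart w s 0 *: partial s f (xpart w).

Definition lift2 p q (f : 'cV[R]_n -> 'M[R]_(p, q)) w : 'M[R]_(p, q) :=
  \sum_s zpart w s 0 *: partial s f (xpart w) +
  2^-1 *: \sum_t \sum_s
    (ypart w t 0 * ypart w s 0) *: partial t (partial s f) (xpart w).

Lemma smooth_on_partial p q s U (f : 'cV[R]_n -> 'M[R]_(p, q)) :
  smooth_on U f -> smooth_on U (partial s f).
Proof. exact: smooth_on_derive. Qed.

Lemma eq_partial p q s U (f g : 'cV[R]_n -> 'M[R]_(p, q)) : open U ->
  (forall x, U x -> f x = g x) -> forall x, U x -> partial s f x = partial s g x.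
Proof.
by move=> oU fg x Ux; apply: near_eq_derive; exact: open_eq_near oU Ux fg.
Qed.

Lemma eq_lift1 p q U (f g : 'cV[R]_n -> 'M[R]_(p, q)) w : open U ->
  (forall x, U x -> f x = g x) -> U (xpart w) -> lift1 f w = lift1 g w.
Proof.
by move=> oU fg Ux; apply: eq_bigr => s _; rewrite (eq_partial s oU fg Ux).
Qed.

Lemma eq_lift2 p q U (f g : 'cV[R]_n -> 'M[R]_(p, q)) w : open U ->
  (forall x, U x -> f x = g x) -> U (xpart w) -> lift2 f w = lift2 g w.
Proof.
move=> oU fg Ux.
have E1 s := eq_partial s oU fg Ux.
have E2 t s := eq_partial t oU (eq_partial s oU fg) Ux.
apply: (f_equal2 +%R); last apply: (f_equal ( *:%R 2^-1)).
  by apply: eq_bigr => s _; rewrite E1.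
by apply: eq_bigr => t _; apply: eq_bigr => s _; rewrite E2.
Qed.

Lemma open_xpart U : open U -> open (@xpart R n @^-1` U).
Proof.
move=> oU; apply: open_comp => // w _; apply: differentiable_continuous.
exact: mx_linear_differentiable.
Qed.

Lemma smooth_on_part (l : {linear T2 -> 'cV[R]_n}) (O : set T2) :
  open O -> smooth_on O l.
Proof. by move=> oO; exact: (smooth_on_linear l oO (@smooth_on_id _ _ O)). Qed.

Lemma smooth_on_xpart_comp p q U (f : 'cV[R]_n -> 'M[R]_(p, q)) : open U ->
  smooth_on U f -> smooth_on (@xpart R n @^-1` U) (fun w => f (xpart w)).
Proof.
move=> oU sf.
apply: (smooth_on_comp (g := @xpart R n) (open_xpart oU) _ _ sf) => //.
exact: smooth_on_part (open_xpart oU).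
Qed.

Lemma smooth_on_coord (l : {linear T2 -> 'cV[R]_n}) (O : set T2) s :
  open O -> smooth_on O (fun w => l w s 0).
Proof.
move=> oO; move: s (0 : 'I_1); apply/smooth_on_mxP => //.
exact: smooth_on_part.
Qed.

Lemma smooth_on_lift1 p q U (f : 'cV[R]_n -> 'M[R]_(p, q)) : open U ->
  smooth_on U f -> smooth_on (@xpart R n @^-1` U) (lift1 f).
Proof.
move=> oU sf; have oX := open_xpart oU; apply: smooth_on_sum => // s.
apply: smooth_onZ => //; first exact: (smooth_on_coord (@ypart R n)).
exact/smooth_on_xpart_comp/smooth_on_partial.
Qed.

Lemma smooth_on_lift2 p q U (f : 'cV[R]_n -> 'M[R]_(p, q)) : open U ->
  smooth_on U f -> smooth_on (@xpart R n @^-1` U) (lift2 f).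
Proof.
move=> oU sf; have oX := open_xpart oU; apply: smooth_onD => //.
  apply: smooth_on_sum => // s.
  apply: smooth_onZ => //; first exact: (smooth_on_coord (@zpart R n)).
  exact/smooth_on_xpart_comp/smooth_on_partial.
apply: smooth_onZ => //; first exact: smooth_on_cst.
apply: smooth_on_sum => // t; apply: smooth_on_sum => // s.
apply: smooth_onZ => //; last first.
  exact/smooth_on_xpart_comp/smooth_on_partial/smooth_on_partial.
by apply: smooth_onM => //; exact: (smooth_on_coord (@ypart R n)).
Qed.

Lemma differentiable_part (l : {linear T2 -> 'cV[R]_n}) s w :
  differentiable (fun w => l w s 0) w.
Proof. exact: smooth_on_differentiable (smooth_on_coord l s openT) I. Qed.

Lemma derive_part (l : {linear T2 -> 'cV[R]_n}) s w v :
  'D_v (fun w => l w s 0) w = l v s 0.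
Proof.
have dl : differentiable l w by exact: mx_linear_differentiable.
rewrite -derive_mxE//; congr (_ s 0).
rewrite deriveE// diff_lin// => u; apply: differentiable_continuous.
exact: mx_linear_differentiable.
Qed.

Lemma differentiable_xpart_comp p q U (f : 'cV[R]_n -> 'M[R]_(p, q)) w :
  open U -> smooth_on U f -> U (xpart w) ->
  differentiable (fun w => f (xpart w)) w.
Proof.
move=> oU sf Ux; exact: smooth_on_differentiable (smooth_on_xpart_comp oU sf) Ux.
Qed.

Lemma derive_partialC p q U (f : 'cV[R]_n -> 'M[R]_(p, q)) s (v x : 'cV[R]_n) :
  open U -> smooth_on U f -> U x ->
  'D_v (partial s f) x = partial s (fun y => 'D_v f y) x.
Proof. exact: derive_derive_comm_mx. Qed.

(** The product rule; the partial derivatives of f depend on w through x only,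
and their derivative along v is rewritten by the symmetry of second
derivatives. The statement covers both sums over the y- and the z-part. *)
Lemma derive_part_sum (l : {linear T2 -> 'cV[R]_n}) p q U
    (f : 'cV[R]_n -> 'M[R]_(p, q)) w v :
  open U -> smooth_on U f -> U (xpart w) ->
  'D_v (fun w => \sum_s l w s 0 *: partial s f (xpart w)) w =
  \sum_s l w s 0 *: partial s (fun x => 'D_(xpart v) f x) (xpart w) +
  'D_(l v) f (xpart w).
Proof.
move=> oU sf Ux.
have dfx s : differentiable (fun w => partial s f (xpart w)) w.
  exact: differentiable_xpart_comp oU (smooth_on_partial s sf) Ux.
rewrite derive_sum_fun => [|s]; last first.
  by apply: differentiable_scale; [exact: differentiable_part|exact: dfx].
rewrite (derive_coord _ (smooth_on_differentiable sf Ux)) addrC -big_split/=.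
apply: eq_bigr => s _.
rewrite (derive_scale _ (differentiable_part l s w) (dfx s)) derive_part.
apply: (f_equal (fun M => l v s 0 *: partial s f (xpart w) + l w s 0 *: M)).
apply: etrans (derive_linear_arg (@xpart R n) _ _ _) _.
exact: derive_partialC oU sf Ux.
Qed.

(** The coefficient of e in D_(v0 + v1 e + v2 e^2) f. *)
Lemma derive_lift1 p q U (f : 'cV[R]_n -> 'M[R]_(p, q)) w v :
  open U -> smooth_on U f -> U (xpart w) ->
  'D_v (lift1 f) w =
  lift1 (fun x => 'D_(xpart v) f x) w + 'D_(ypart v) f (xpart w).
Proof. exact: (derive_part_sum (@ypart R n)). Qed.

(** Seen as a sum of first lifts of partial derivatives, the quadratic term is
differentiated by derive_lift1. *)
Lemma lift2E p q (f : 'cV[R]_n -> 'M[R]_(p, q)) w :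
  lift2 f w = \sum_s zpart w s 0 *: partial s f (xpart w) +
              2^-1 *: \sum_s ypart w s 0 *: lift1 (partial s f) w.
Proof.
apply: (f_equal (fun M => _ + 2^-1 *: M)); rewrite exchange_big/=.
apply: eq_bigr => s _; rewrite scaler_sumr; apply: eq_bigr => t _.
by rewrite scalerA mulrC.
Qed.

(** The coefficient of e^2 in D_(v0 + v1 e + v2 e^2) f: the component v_i
comes with the lift of order 2 - i, so that replacing v by e v = (0, v0, v1)
leaves the sum in derive_lift1, for the directions v0 and v1. *)
Lemma derive_lift2 p q U (f : 'cV[R]_n -> 'M[R]_(p, q)) w v :
  open U -> smooth_on U f -> U (xpart w) ->
  'D_v (lift2 f) w =
  lift2 (fun x => 'D_(xpart v) f x) w + lift1 (fun x => 'D_(ypart v) f x) w +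
  'D_(zpart v) f (xpart w).
Proof.
move=> oU sf Ux; have oX := open_xpart oU.
have sfs s := smooth_on_partial s sf.
have dl1 s : differentiable (lift1 (partial s f)) w.
  exact: smooth_on_differentiable (smooth_on_lift1 oU (sfs s)) Ux.
have dfx s : differentiable (fun w => partial s f (xpart w)) w.
  exact: differentiable_xpart_comp oU (sfs s) Ux.
have dy s := differentiable_part (@ypart R n) s w.
pose lz w := \sum_s zpart w s 0 *: partial s f (xpart w).
pose qy w := \sum_s ypart w s 0 *: lift1 (partial s f) w.
have dlz : differentiable lz w.
  rewrite (_ : lz = \sum_s (fun w => zpart w s 0 *: partial s f (xpart w))).
    apply: differentiable_sum => s; apply: differentiable_scale (dfx s).
    exact: (differentiable_part (@zpart R n)).
  by apply/funext => u; rewrite fct_sumE.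
have dqy : differentiable qy w.
  rewrite (_ : qy = \sum_s (fun w => ypart w s 0 *: lift1 (partial s f) w)).
    by apply: differentiable_sum => s; exact: differentiable_scale (dl1 s).
  by apply/funext => u; rewrite fct_sumE.
have -> : lift2 f = lz + 2^-1 *: qy by apply/funext => u; rewrite lift2E.
rewrite deriveD; last 2 first.
- exact: diff_derivable.
- by apply: diff_derivable; exact: differentiableZ.
rewrite deriveZ; last exact: diff_derivable.
rewrite (derive_part_sum (@zpart R n) v oU sf Ux) lift2E.
rewrite -!addrA; apply: (f_equal (fun M => _ + M)); rewrite addrA addrC.
apply: (f_equal (fun M => M + _)).
have E1 s : 'D_v (lift1 (partial s f)) w =
    lift1 (partial s (fun x => 'D_(xpart v) f x)) w +
    partial s (fun x => 'D_(ypart v) f x) (xpart w).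
  rewrite (derive_lift1 v oU (sfs s) Ux).
  rewrite (derive_partialC s _ oU sf Ux); apply: (f_equal (fun M => M + _)).
  apply: (eq_lift1 oU _ Ux) => x; exact: derive_partialC oU sf.
have -> : 'D_v qy w = \sum_s (ypart v s 0 *: lift1 (partial s f) w +
   ypart w s 0 *: (lift1 (partial s (fun x => 'D_(xpart v) f x)) w +
    partial s (fun x => 'D_(ypart v) f x) (xpart w))).
  rewrite derive_sum_fun => [|s]; last exact: differentiable_scale (dl1 s).
  apply: eq_bigr => s _; rewrite (derive_scale _ (dy s) (dl1 s)) E1.
  apply: (f_equal (fun r => r *: _ + _)); exact: (derive_part (@ypart R n)).
(* the two halves of the derivative of the quadratic term agree *)
have E2 : \sum_s ypart v s 0 *: lift1 (partial s f) w =
    lift1 (fun x => 'D_(ypart v) f x) w.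
  under eq_bigr do rewrite scaler_sumr.
  rewrite exchange_big; apply: eq_bigr => t _ /=.
  apply: etrans _ (f_equal ( *:%R _) (derive_partialC t _ oU sf Ux)).
  rewrite (derive_coord _ (smooth_on_differentiable (sfs t) Ux)) scaler_sumr.
  apply: eq_bigr => s _; rewrite !scalerA mulrC; apply: (f_equal ( *:%R _)).
  exact: derive_derive_comm_mx oU sf Ux.
rewrite big_scaleD; exact: half_double E2.
Qed.

End Lift.

(** * Two-jets of curves *)

Lemma open_setI_preimage (S T : topologicalType) (f : S -> T) (O : set S)
    (U : set T) : open O -> open U ->
  (forall x, O x -> {for x, continuous f}) -> open (O `&` f @^-1` U).
Proof.
move=> oO oU cf; rewrite openE => x [Ox Ufx].
apply: filterI; first exact: open_nbhs_nbhs.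
by apply: (cf x Ox); exact: open_nbhs_nbhs.
Qed.

Section Curve.
Context {R : realType} {n : nat}.
Implicit Types (O : set R) (U : set 'cV[R]_n) (F : R -> 'cV[R]_n).

(** The induced coordinates of the 2-jet at 0 of a curve written in a chart. *)
Definition curve_jet F : 'cV[R]_(n + (n + n)) :=
  col_mx (F 0) (col_mx (derive1 F 0) (2^-1 *: derive1n 2 F 0)).

Lemma xpart_col (x y z : 'cV[R]_n) : xpart (col_mx x (col_mx y z)) = x.
Proof. by rewrite /xpart col_mxKu. Qed.
Lemma ypart_col (x y z : 'cV[R]_n) : ypart (col_mx x (col_mx y z)) = y.
Proof. by rewrite /ypart col_mxKd col_mxKu. Qed.
Lemma zpart_col (x y z : 'cV[R]_n) : zpart (col_mx x (col_mx y z)) = z.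
Proof. by rewrite /zpart !col_mxKd. Qed.
Lemma partE (w : 'cV[R]_(n + (n + n))) :
  col_mx (xpart w) (col_mx (ypart w) (zpart w)) = w.
Proof. by rewrite /xpart /ypart /zpart !vsubmxK. Qed.

Lemma derive1_near p q (f g : R -> 'M[R]_(p, q)) O t : open O -> O t ->
  (forall t, O t -> f t = g t) -> derive1 f t = derive1 g t.
Proof.
by move=> oO Ot fg; rewrite !derive1E; apply: near_eq_derive;
  exact: open_eq_near oO Ot fg.
Qed.

Lemma derive1_curve p q O U F (f : 'cV[R]_n -> 'M[R]_(p, q)) t :
  smooth_on O F -> smooth_on U f -> O t -> U (F t) ->
  derive1 (f \o F) t = \sum_s derive1 F t s 0 *: partial s f (F t).
Proof.
move=> sF sf Ot Ut; rewrite !derive1E derive_comp.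
- by rewrite (derive_coord _ (smooth_on_differentiable sf Ut)).
- exact: smooth_on_differentiable sF Ot.
- exact: smooth_on_differentiable sf Ut.
Qed.

Lemma smooth_on_derive1 (W : normedModType R) O (f : R -> W) :
  smooth_on O f -> smooth_on O (derive1 f).
Proof.
move=> sf; rewrite (_ : derive1 f = fun t => 'D_1 f t).
  exact: smooth_on_derive.
by apply/funext => t; rewrite derive1E.
Qed.

Lemma lift1_curve p q O U F (f : 'cV[R]_n -> 'M[R]_(p, q)) :
  smooth_on O F -> smooth_on U f -> O 0 -> U (F 0) ->
  derive1 (f \o F) 0 = lift1 f (curve_jet F).
Proof.
move=> sF sf O0 U0; rewrite (derive1_curve sF sf O0 U0).
by rewrite /lift1 xpart_col ypart_col.
Qed.

(** The second-order chain rule: the lifts of f describe the action of f on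
2-jets of curves. *)
Lemma lift2_curve p q O U F (f : 'cV[R]_n -> 'M[R]_(p, q)) :
  open O -> open U -> smooth_on O F -> smooth_on U f -> O 0 -> U (F 0) ->
  2^-1 *: derive1n 2 (f \o F) 0 = lift2 f (curve_jet F).
Proof.
move=> oO oU sF sf O0 U0.
have oO' : open (O `&` F @^-1` U).
  apply: (open_setI_preimage oO oU) => t Ot; apply: differentiable_continuous.
  exact: smooth_on_differentiable sF Ot.
have sF' := smooth_on_derive1 sF.
have dF' s : differentiable (fun t => derive1 F t s 0) 0.
  move: s (0 : 'I_1); apply/differentiable_mxP.
  exact: smooth_on_differentiable sF' O0.
have dfF s : differentiable (partial s f \o F) 0.
  apply: differentiable_comp; first exact: smooth_on_differentiable sF O0.
  exact: smooth_on_differentiable (smooth_on_partial s sf) U0.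
have -> : derive1n 2 (f \o F) 0 = \sum_s (
    derive1n 2 F 0 s 0 *: partial s f (F 0) +
    derive1 F 0 s 0 *: lift1 (partial s f) (curve_jet F)).
  have -> : derive1n 2 (f \o F) 0 =
      derive1 (fun t => \sum_s derive1 F t s 0 *: partial s f (F t)) 0.
    apply: derive1_near oO' _ _ => // t [Ot Ut]; exact: derive1_curve sF sf Ot Ut.
  rewrite derive1E derive_sum_fun => [|s]; last first.
    by apply: differentiable_scale; [exact: dF'|exact: dfF].
  apply: eq_bigr => s _; rewrite (derive_scale _ (dF' s) (dfF s)).
  rewrite -(lift1_curve sF (smooth_on_partial s sf) O0 U0).
  rewrite [derive1 (partial s f \o F) 0]derive1E.
  have -> : derive1n 2 F 0 s 0 = 'D_1 (fun t => derive1 F t s 0) 0 => //.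
  rewrite -(derive_mxE _ _ _ (smooth_on_differentiable sF' O0)).
  by rewrite derive1nS derive1n1 derive1E.
rewrite lift2E xpart_col zpart_col ypart_col big_split scalerDr.
apply: (f_equal (fun M => M + _)).
by rewrite scaler_sumr; apply: eq_bigr => s _; rewrite scalerA mxE.
Qed.

(** For sg = id this is the simplest curve with 2-jet w; a bounded sg with the
same 2-jet as id at 0 keeps the curve in a prescribed neighbourhood of x. *)
Definition qcurve (sg : R -> R) (w : 'cV[R]_(n + (n + n))) (t : R) : 'cV[R]_n :=
  xpart w + (sg t *: ypart w + (sg t * sg t) *: zpart w).

Lemma smooth_on_qcurve (sg : R -> R) w :
  smooth_on setT sg -> smooth_on setT (qcurve sg w).
Proof.
move=> sgs; have cst := smooth_on_cst; have oT := @openT R.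
apply: smooth_onD => //; first exact: cst.
apply: smooth_onD => //; apply: smooth_onZ => //; try exact: cst.
exact: smooth_onM.
Qed.

Lemma derive1_qcurve (sg : R -> R) w t : smooth_on setT sg ->
  derive1 (qcurve sg w) t =
  derive1 sg t *: ypart w + (2 * sg t * derive1 sg t) *: zpart w.
Proof.
move=> sgs.
have dsg : differentiable sg t by exact: smooth_on_differentiable sgs I.
have dss : differentiable (fun t => sg t * sg t) t by exact: differentiableM.
rewrite derive1E; transitivity ('D_1 (cst (xpart w) +
    ((fun t => sg t *: cst (ypart w) t) +
     (fun t => (sg t * sg t) *: cst (zpart w) t))) t) => //.
have d1 := differentiable_scale dsg (differentiable_cst (ypart w) t).
have d2 := differentiable_scale dss (differentiable_cst (zpart w) t).
rewrite deriveD; [|exact: derivable_cst|]; last first.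
  by apply: diff_derivable; exact: differentiableD.
rewrite derive_cst add0r deriveD; [|exact: diff_derivable..].
rewrite !derive_scale ?derive_cst ?scaler0 ?addr0//.
rewrite derive_mul// derive1E; congr (_ + _ *: _); ring.
Qed.

Lemma derive1n2_qcurve (sg : R -> R) w : smooth_on setT sg ->
  sg 0 = 0 -> derive1 sg 0 = 1 -> derive1n 2 sg 0 = 0 ->
  derive1n 2 (qcurve sg w) 0 = 2 *: zpart w.
Proof.
move=> sgs sg0 sg1 sg2.
have dsg : differentiable sg 0 by exact: smooth_on_differentiable sgs I.
have dsg' : differentiable (derive1 sg) 0.
  exact: smooth_on_differentiable (smooth_on_derive1 sgs) I.
have -> : derive1n 2 (qcurve sg w) 0 =
    'D_1 ((fun t => derive1 sg t *: cst (ypart w) t) +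
          (fun t => (2 * sg t * derive1 sg t) *: cst (zpart w) t)) 0.
  rewrite -derive1E; apply: derive1_near (@openT R) _ _ => // t _.
  exact: derive1_qcurve.
have d2s : differentiable (fun t => 2 * sg t) 0 by exact: differentiableM.
have d2ss : differentiable (fun t => 2 * sg t * derive1 sg t) 0.
  exact: differentiableM.
have d1 := differentiable_scale dsg' (differentiable_cst (ypart w) (0 : R)).
have d2 := differentiable_scale d2ss (differentiable_cst (zpart w) (0 : R)).
rewrite deriveD; [|exact: diff_derivable..].
rewrite !derive_scale ?derive_cst ?scaler0 ?addr0//.
have -> : 'D_1 (derive1 sg) 0 = 0 by rewrite -derive1E.
rewrite scale0r add0r derive_mul// derive_mul// derive_cst -!derive1E sg0 sg1.
by congr (_ *: _); ring.
Qed.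

Lemma curve_jet_qcurve (sg : R -> R) w : smooth_on setT sg ->
  sg 0 = 0 -> derive1 sg 0 = 1 -> derive1n 2 sg 0 = 0 ->
  curve_jet (qcurve sg w) = w.
Proof.
move=> sgs sg0 sg1 sg2; rewrite /curve_jet derive1n2_qcurve// derive1_qcurve//.
rewrite /qcurve sg0 sg1 !(mulr0, mul0r, scale0r, addr0, scale1r).
by rewrite scalerA mulVf ?pnatr_eq0// scale1r partE.
Qed.

End Curve.

(** * Lifts of composites and products *)

Section LiftRules.
Context {R : realType} {n : nat}.
Implicit Types (U : set 'cV[R]_n) (w : 'cV[R]_(n + (n + n))).

Lemma curve_with_jet w : exists F : R -> 'cV[R]_n,
  [/\ smooth_on setT F, F 0 = xpart w & curve_jet F = w].
Proof.
have s1 : derive1 (@id R) = cst 1.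
  by apply/funext => t; rewrite derive1E derive_id.
exists (qcurve (@id R) w); split.
- exact/smooth_on_qcurve/smooth_on_id.
- by rewrite /qcurve mulr0 !scale0r !addr0.
- apply: curve_jet_qcurve => //; first exact: smooth_on_id.
    by rewrite s1.
  by rewrite derive1nS derive1n1 s1 derive1_cst.
Qed.

(** The map induced by phi on 2-jets. *)
Definition jlift (phi : 'cV[R]_n -> 'cV[R]_n) w : 'cV[R]_(n + (n + n)) :=
  col_mx (phi (xpart w)) (col_mx (lift1 phi w) (lift2 phi w)).

Lemma curve_jet_comp O U (phi : 'cV[R]_n -> 'cV[R]_n) (F : R -> 'cV[R]_n) :
  open O -> open U -> smooth_on O F -> smooth_on U phi -> O 0 -> U (F 0) ->
  curve_jet (phi \o F) = jlift phi (curve_jet F).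
Proof.
move=> oO oU sF sphi O0 U0; rewrite /jlift xpart_col.
by rewrite -(lift1_curve sF sphi O0 U0) -(lift2_curve oO oU sF sphi O0 U0).
Qed.

Section Composition.
Context (p q : nat) (U U' : set 'cV[R]_n) (f : 'cV[R]_n -> 'M[R]_(p, q))
  (phi : 'cV[R]_n -> 'cV[R]_n) (w : 'cV[R]_(n + (n + n))).
Hypotheses (oU : open U) (oU' : open U') (UU' : U `<=` phi @^-1` U').
Hypotheses (sphi : smooth_on U phi) (sf : smooth_on U' f) (Ux : U (xpart w)).

(** Both sides are read off along a curve F with 2-jet w: the curve phi o F has
2-jet jlift phi w. *)
Lemma lift_comp :
  lift1 (f \o phi) w = lift1 f (jlift phi w) /\
  lift2 (f \o phi) w = lift2 f (jlift phi w).
Proof.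
have [F [sF F0 jF]] := curve_with_jet w.
have sfphi := smooth_on_comp oU UU' sphi sf.
have oO : open (F @^-1` U).
  rewrite -[F @^-1` U]setTI; apply: open_setI_preimage oU _ => [|t _].
    exact: openT.
  by apply: differentiable_continuous; exact: smooth_on_differentiable sF I.
have sF' : smooth_on (F @^-1` U) F by exact: smooth_on_sub sF.
have O0 : (F @^-1` U) 0 by rewrite /= F0.
have sphiF : smooth_on (F @^-1` U) (phi \o F) by exact: smooth_on_comp sF' sphi.
have U'0 : U' ((phi \o F) 0) by exact: UU'.
have jphiF := curve_jet_comp oO oU sF' sphi O0 O0.
rewrite -{1 3}jF -jF -jphiF; split.
  by rewrite -(lift1_curve sF' sfphi O0 O0) -(lift1_curve sphiF sf O0 U'0).
rewrite -(lift2_curve oO oU sF' sfphi O0 O0).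
by rewrite -(lift2_curve oO oU' sphiF sf O0 U'0).
Qed.

End Composition.

Section Product.
Context (p q r : nat) (U : set 'cV[R]_n) (M : 'cV[R]_n -> 'M[R]_(p, q))
  (N : 'cV[R]_n -> 'M[R]_(q, r)) (w : 'cV[R]_(n + (n + n))).
Hypotheses (oU : open U) (sM : smooth_on U M) (sN : smooth_on U N)
  (Ux : U (xpart w)).

(** The Leibniz rule along a curve with 2-jet w. In lift2 the factor 1/2 cancels
the multiplicity 2 of the middle term. *)
Lemma lift_mulmx :
  lift1 (fun x => M x *m N x) w =
    lift1 M w *m N (xpart w) + M (xpart w) *m lift1 N w /\
  lift2 (fun x => M x *m N x) w =
    lift2 M w *m N (xpart w) + lift1 M w *m lift1 N w +
    M (xpart w) *m lift2 N w.
Proof.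
have [F [sF F0 jF]] := curve_with_jet w.
have sMN := smooth_on_mulmx oU sM sN.
have oO : open (F @^-1` U).
  rewrite -[F @^-1` U]setTI; apply: open_setI_preimage oU _ => [|t _].
    exact: openT.
  by apply: differentiable_continuous; exact: smooth_on_differentiable sF I.
have sF' : smooth_on (F @^-1` U) F by exact: smooth_on_sub sF.
have O0 : (F @^-1` U) 0 by rewrite /= F0.
have OU : F @^-1` U `<=` F @^-1` U by [].
have sMF := smooth_on_comp oO OU sF' sM.
have sNF := smooth_on_comp oO OU sF' sN.
have E1 t : U (F t) -> derive1 ((fun x => M x *m N x) \o F) t =
    derive1 (M \o F) t *m (N \o F) t + (M \o F) t *m derive1 (N \o F) t.
  move=> Ut; rewrite !derive1E -derive_mulmx//.
    exact: smooth_on_differentiable sMF Ut.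
  exact: smooth_on_differentiable sNF Ut.
have E2 : derive1n 2 ((fun x => M x *m N x) \o F) 0 =
    derive1n 2 (M \o F) 0 *m N (F 0) +
    2 *: (derive1 (M \o F) 0 *m derive1 (N \o F) 0) +
    M (F 0) *m derive1n 2 (N \o F) 0.
  have -> : derive1n 2 ((fun x => M x *m N x) \o F) 0 = 'D_1 (
     (fun t => derive1 (M \o F) t *m (N \o F) t) +
     (fun t => (M \o F) t *m derive1 (N \o F) t)) 0.
    rewrite -derive1E derive1nS derive1n1; apply: derive1_near oO O0 _ => t Ut.
    exact: E1.
  have dM := smooth_on_differentiable sMF O0.
  have dN := smooth_on_differentiable sNF O0.
  have dM' := smooth_on_differentiable (smooth_on_derive1 sMF) O0.
  have dN' := smooth_on_differentiable (smooth_on_derive1 sNF) O0.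
  have sMN1 := smooth_on_mulmx oO (smooth_on_derive1 sMF) sNF.
  have sMN2 := smooth_on_mulmx oO sMF (smooth_on_derive1 sNF).
  have dd1 := smooth_on_differentiable sMN1 O0.
  have dd2 := smooth_on_differentiable sMN2 O0.
  rewrite deriveD; [|exact: diff_derivable..].
  rewrite (derive_mulmx _ dM' dN) (derive_mulmx _ dM dN').
  rewrite !derive1nS !derive1n0 -!derive1E scaler_nat mulr2n.
  by rewrite !addrA.
rewrite -F0 -jF -(lift1_curve sF' sMN O0 O0) -(lift1_curve sF' sM O0 O0).
rewrite -(lift1_curve sF' sN O0 O0) -(lift2_curve oO oU sF' sMN O0 O0).
rewrite -(lift2_curve oO oU sF' sM O0 O0) -(lift2_curve oO oU sF' sN O0 O0).
split; first exact: E1.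
rewrite E2 !scalerDr scalerA mulVf ?pnatr_eq0// scale1r.
by rewrite -scalemxAl -scalemxAr.
Qed.

End Product.

Section Linear.
Context (p q p' q' : nat) (l : {linear 'M[R]_(p, q) -> 'M[R]_(p', q')})
  (U : set 'cV[R]_n) (f : 'cV[R]_n -> 'M[R]_(p, q)).
Hypotheses (oU : open U) (sf : smooth_on U f).

Lemma partial_linear s x : U x -> partial s (l \o f) x = l (partial s f x).
Proof.
move=> Ux; apply: derive_linear_comp; exact: smooth_on_differentiable sf Ux.
Qed.

Lemma lift1_linear w : U (xpart w) -> lift1 (l \o f) w = l (lift1 f w).
Proof.
move=> Ux; rewrite linear_sum; apply: eq_bigr => s _.
by rewrite linearZ (partial_linear s Ux).
Qed.

End Linear.

Lemma lift2_linear p q p' q' (l : {linear 'M[R]_(p, q) -> 'M[R]_(p', q')})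
    U (f : 'cV[R]_n -> 'M[R]_(p, q)) w : open U -> smooth_on U f ->
  U (xpart w) -> lift2 (l \o f) w = l (lift2 f w).
Proof.
move=> oU sf Ux; rewrite lift2E (lift2E f) linearD.
apply: (f_equal2 +%R).
  rewrite linear_sum; apply: eq_bigr => s _.
  by rewrite linearZ (partial_linear l sf s Ux).
rewrite [RHS]linearZZ; apply: (f_equal ( *:%R 2^-1)); rewrite linear_sum.
apply: eq_bigr => s _; rewrite [RHS]linearZZ; apply: (f_equal ( *:%R _)).
rewrite -(lift1_linear l (smooth_on_partial s sf) Ux).
by apply: (eq_lift1 oU _ Ux) => x; exact: partial_linear.
Qed.

End LiftRules.

(** The Leibniz rule applied to the transformation law of a (0,2)-tensor; P0,
P1 and P2 are the lifts of J^T H. *)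
Lemma lift_congruence (R : realType) n (U : set 'cV[R]_n)
    (J H : 'cV[R]_n -> 'M[R]_n) w : open U -> smooth_on U J -> smooth_on U H ->
  U (xpart w) ->
  let J0 := J (xpart w) in let J1 := lift1 J w in let J2 := lift2 J w in
  let H0 := H (xpart w) in let H1 := lift1 H w in let H2 := lift2 H w in
  let P0 := J0^T *m H0 in
  let P1 := J1^T *m H0 + J0^T *m H1 in
  let P2 := J2^T *m H0 + J1^T *m H1 + J0^T *m H2 in
  lift1 (fun x => (J x)^T *m H x *m J x) w = P1 *m J0 + P0 *m J1 /\
  lift2 (fun x => (J x)^T *m H x *m J x) w = P2 *m J0 + P1 *m J1 + P0 *m J2.
Proof.
move=> oU sJ sH Ux; have sJT := smooth_on_linear trmx oU sJ.
have sP := smooth_on_mulmx oU sJT sH.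
have [E1 E2] := lift_mulmx oU sP sJ Ux.
have [E3 E4] := lift_mulmx oU sJT sH Ux.
rewrite E3 (lift1_linear trmx sJ Ux) in E1 E2 E4.
rewrite E4 (lift2_linear trmx oU sJ Ux) in E2.
by split; [exact: E1|exact: E2].
Qed.

Lemma smooth_on_jlift (R : realType) n (U : set 'cV[R]_n)
    (phi : 'cV[R]_n -> 'cV[R]_n) : open U -> smooth_on U phi ->
  smooth_on (@xpart R n @^-1` U) (jlift phi).
Proof.
move=> oU sphi; have oX := open_xpart oU.
apply: smooth_on_col_mx => //; first exact: smooth_on_xpart_comp.
apply: smooth_on_col_mx => //; first exact: smooth_on_lift1.
exact: smooth_on_lift2.
Qed.

(** * Charts and curves of the base manifold *)

(** Injectivity of the chart at p is a hypothesis, so that the lemma also serves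
the atlas of T2M while its charts are being studied. *)
Lemma ctransitionE (R : realType) (m : nat) (N : Type) (A : atlas R m N)
    (a b : chart_index A) p :
  (forall q, cdom a p -> cdom a q -> cmap a p = cmap a q -> p = q) ->
  cdom a p -> cdom b p -> ctransition a b (cmap a p) = cmap b p.
Proof.
move=> inj ap bp; rewrite /ctransition.
have : (cmap b @` [set q | [/\ cdom a q, cdom b q & cmap a q = cmap a p]])
  (cmap b p) by exists p.
by move=> /(xgetI 0)[q [aq bq /esym/(inj q ap aq) <-]].
Qed.

Section Charts.
Context {R : realType} {n : nat} {M : topologicalType} {A : atlas R n M}.
Hypothesis man : smooth_manifold A.
Implicit Types (a b : chart_index A) (p q : M).

Lemma open_cimage a : open (cimage a).
Proof. by apply: (chart_open_map man) => //; exact: chart_open_dom. Qed.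

Lemma open_coverlap a b : open (coverlap a b).
Proof.
apply: (chart_open_map man) => [|p []//].
by apply: openI; exact: (chart_open_dom man).
Qed.

Lemma transition_cmap a b p :
  cdom a p -> cdom b p -> ctransition a b (cmap a p) = cmap b p.
Proof. by move=> ap bp; apply: ctransitionE => // q; exact: chart_inj. Qed.

Lemma open_dom_preimage a b (F : R -> M) : continuous F ->
  open (F @^-1` (cdom a `&` cdom b)).
Proof.
by move=> cF; apply: open_comp => [t _|]; [exact: cF|
  apply: openI; exact: (chart_open_dom man)].
Qed.

(** The inverse of a chart is continuous because charts are open maps, and in
any other chart the lifted curve is the image of c by a transition map. *)
Lemma lift_curve_chart a (c : R -> 'cV[R]_n) :
  smooth_on setT c -> (forall t, cimage a (c t)) ->
  exists F, [/\ smooth_curve A F, forall t, cdom a (F t) & cmap a \o F = c].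
Proof.
move=> sc ac.
have /choice[F FP] : forall t, exists p, cdom a p /\ cmap a p = c t.
  by move=> t; have [p] := ac t; exists p.
have aF t : cdom a (F t) by have [] := FP t.
have cF t : cmap a (F t) = c t by have [] := FP t.
have contF : continuous F.
  move=> t O /=; rewrite nbhsE => -[Q [oQ Qt] QO].
  have oQa : open (Q `&` cdom a).
    by apply: openI => //; exact: (chart_open_dom man).
  have oI : open (cmap a @` (Q `&` cdom a)).
    by apply: (chart_open_map man) => // p [].
  have : nbhs (c t) (cmap a @` (Q `&` cdom a)).
    by apply: open_nbhs_nbhs; split => //; exists (F t).
  have /differentiable_continuous cc := smooth_on_differentiable sc (x := t) I.
  move=> /cc; apply: (@filterS _ (nbhs t) _ (c @^-1` _) (F @^-1` O)).
  move=> s /= [p [Qp ap]]; rewrite -cF => pFs.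
  have <- : p = F s by exact: chart_inj ap (aF s) pFs.
  exact: QO.
exists F; split => //; last by apply/funext.
split=> // b.
have oO : open (F @^-1` cdom b).
  apply: open_comp => [t _|]; [exact: contF|exact: (chart_open_dom man)].
have sT : smooth_on (F @^-1` cdom b) (ctransition a b \o c).
  have := smooth_on_comp oO _ (smooth_on_sub _ sc)
    (@chart_smooth _ _ _ _ man a b).
  apply=> // t bt; exists (F t) => //; split => //; exact: aF.
apply: smooth_on_eq sT => // t bt; rewrite /= -cF transition_cmap//.
Qed.

Lemma curve_jet_inj (F G : R -> 'cV[R]_n) : curve_jet F = curve_jet G ->
  [/\ F 0 = G 0, derive1 F 0 = derive1 G 0 & derive1n 2 F 0 = derive1n 2 G 0].
Proof.
have half0 : 2^-1 != 0 :> R by rewrite invr_eq0 pnatr_eq0.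
rewrite /curve_jet => /eq_col_mx[E0 /eq_col_mx[E1 E2]].
split; [exact: E0|exact: E1|exact: (scalerI half0 E2)].
Qed.

Lemma curve_jet_eq (F G : R -> 'cV[R]_n) (O : set R) : open O -> O 0 ->
  (forall t, O t -> F t = G t) -> curve_jet F = curve_jet G.
Proof.
move=> oO O0 FG; rewrite /curve_jet (FG 0 O0) (derive1_near oO O0 FG).
do 2 apply: f_equal; apply: (f_equal ( *:%R _)).
by apply: (derive1_near oO O0) => t Ot; exact: (derive1_near oO Ot FG).
Qed.

(** Near 0 the two local expressions of F differ by the transition map. *)
Lemma curve_jet_transition a b F : smooth_curve A F ->
  cdom a (F 0) -> cdom b (F 0) ->
  curve_jet (cmap b \o F) =
  jlift (ctransition a b) (curve_jet (cmap a \o F)).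
Proof.
move=> [cF sF] a0 b0.
have oO : open (F @^-1` (cdom a `&` cdom b)) by exact: open_dom_preimage.
have sFa : smooth_on (F @^-1` (cdom a `&` cdom b)) (cmap a \o F).
  by apply: smooth_on_sub (sF a) => t [].
have E t : (F @^-1` (cdom a `&` cdom b)) t ->
    (cmap b \o F) t = (ctransition a b \o (cmap a \o F)) t.
  by move=> [aF bF]; rewrite /= transition_cmap.
rewrite (curve_jet_eq oO _ E)//.
apply: (curve_jet_comp oO (@open_coverlap a b) sFa
  (@chart_smooth _ _ _ _ man a b)) => //.
by exists (F 0).
Qed.

(** The definition of a 2-jet quantifies over all charts; by
curve_jet_transition a single chart decides. *)
Lemma same_2jetP a F G : smooth_curve A F -> smooth_curve A G ->
  cdom a (F 0) -> cdom a (G 0) ->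
  curve_jet (cmap a \o F) = curve_jet (cmap a \o G) -> same_2jet A F G.
Proof.
move=> sF sG aF aG E.
have FG : F 0 = G 0.
  by have [+ _ _] := curve_jet_inj E; exact: (chart_inj man aF aG).
split; first exact: FG.
move=> b bF; have bG : cdom b (G 0) by rewrite -FG.
have := curve_jet_transition sG aG bG.
rewrite -E -(curve_jet_transition sF aF bF).
by move=> /curve_jet_inj[_ E1 E2]; split; [exact: esym E1|exact: esym E2].
Qed.

Lemma same_2jet_curve_jet a F G : same_2jet A F G -> cdom a (F 0) ->
  curve_jet (cmap a \o F) = curve_jet (cmap a \o G).
Proof.
move=> [FG0 FG] aF; have [E1 E2] := FG a aF.
have E0 : (cmap a \o F) 0 = (cmap a \o G) 0 by rewrite /= FG0.
by rewrite /curve_jet E0 E1 E2.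
Qed.

Lemma jet2_rep_smooth (p : jet2 A) : smooth_curve A (jet2_rep p).
Proof. by rewrite /jet2_rep; case: cid2. Qed.

Lemma jet2_repE (p : jet2 A) : sval p = jet2_class A (jet2_rep p).
Proof. by rewrite /jet2_rep; case: cid2. Qed.

Lemma same_2jet_sym F G : same_2jet A F G -> same_2jet A G F.
Proof.
move=> [F0 FG]; split; first exact: esym F0.
by move=> a; rewrite -F0 => /FG[E1 E2]; split; [exact: esym E1|exact: esym E2].
Qed.

Lemma same_2jet_trans F G H :
  same_2jet A F G -> same_2jet A G H -> same_2jet A F H.
Proof.
move=> [F0 FG] [G0 GH]; split=> [|a aF]; first exact: etrans F0 G0.
have [E1 E2] := FG a aF; have aG : cdom a (G 0) by rewrite -F0.
have [E3 E4] := GH a aG.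
by rewrite E1 E2; split; [exact: E3|exact: E4].
Qed.

Lemma jet2_of_curve F : smooth_curve A F ->
  exists p : jet2 A, same_2jet A (jet2_rep p) F.
Proof.
move=> sF; pose p : jet2 A := exist _ (jet2_class A F)
  (ex_intro2 _ _ F sF erefl).
exists p; have : sval p F by split.
by rewrite jet2_repE => -[].
Qed.

(** A jet is the class of its representative, and related curves have equal
classes. *)
Lemma jet2_eq (p q : jet2 A) : same_2jet A (jet2_rep p) (jet2_rep q) -> p = q.
Proof.
move=> pq; have E : sval p = sval q.
  apply: etrans (jet2_repE p) (etrans _ (esym (jet2_repE q))).
  apply/seteqP; split=> F [sF jF]; (split; first exact: sF).
    exact: same_2jet_trans (same_2jet_sym pq) jF.
  exact: same_2jet_trans pq jF.
by case: p q E {pq} => [J pJ] [K pK] /= E; exact: eq_exist.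
Qed.

End Charts.

(** * The second-order tangent bundle as a manifold *)

Section Sine.
Context {R : realType}.

Lemma derive_real (f : R -> R) (t v : R) :
  differentiable f t -> 'D_v f t = v * 'D_1 f t.
Proof.
move=> df; rewrite !deriveE//.
by rewrite -[v in LHS]mulr1 -[v * 1]/(v *: (1 : R)) linearZ.
Qed.

Lemma is_derive_sin_scaled (a b t : R) :
  is_derive t 1 (fun t => a * sin (b * t)) (a * b * cos (b * t)).
Proof. by apply: is_derive_eq; rewrite /GRing.scale /=; ring. Qed.

Lemma is_derive_cos_scaled (a b t : R) :
  is_derive t 1 (fun t => a * cos (b * t)) (- (a * b) * sin (b * t)).
Proof. by apply: is_derive_eq; rewrite /GRing.scale /=; ring. Qed.

Lemma Cdiff_sin_cos k (a b : R) :
  Cdiff k setT (fun t : R => a * sin (b * t)) /\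
  Cdiff k setT (fun t : R => a * cos (b * t)).
Proof.
have ds c t : differentiable (fun t => c * sin (b * t)) t.
  by apply/derivable1_diffP; case: (is_derive_sin_scaled c b t).
have dc c t : differentiable (fun t => c * cos (b * t)) t.
  by apply/derivable1_diffP; case: (is_derive_cos_scaled c b t).
elim: k a => [|k IH] a; first by split; split.
split; split=> // v.
  rewrite (_ : (fun t => _) = (fun t => (v * (a * b)) * cos (b * t))).
    by have [] := IH (v * (a * b)).
  apply/funext => t; rewrite derive_real// -mulrA.
  by rewrite (@derive_val _ _ _ _ _ _ _ (is_derive_sin_scaled a b t)).
rewrite (_ : (fun t => _) = (fun t => (v * - (a * b)) * sin (b * t))).
  by have [] := IH (v * - (a * b)).
apply/funext => t; rewrite derive_real// -mulrA.
by rewrite (@derive_val _ _ _ _ _ _ _ (is_derive_cos_scaled a b t)).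
Qed.

(** The function d sin(t/d). It replaces a cut-off of the identity: curves in T2M
are represented by curves on the whole line that must not leave a chart. *)
Lemma bounded_unit_speed (d : R) : 0 < d -> exists sg : R -> R,
  [/\ smooth_on setT sg, sg 0 = 0, derive1 sg 0 = 1, derive1n 2 sg 0 = 0 &
      forall t, `|sg t| <= d].
Proof.
move=> d0; exists (fun t => d * sin (d^-1 * t)).
have dn0 : d != 0 by exact: lt0r_neq0.
have D1 : derive1 (fun t => d * sin (d^-1 * t)) = (fun t => 1 * cos (d^-1 * t)).
  apply/funext => t; rewrite derive1E.
  by rewrite (@derive_val _ _ _ _ _ _ _ (is_derive_sin_scaled d d^-1 t)) divff.
split.
- by apply/smooth_onP => k; have [] := Cdiff_sin_cos k d d^-1.
- by rewrite mulr0 sin0 mulr0.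
- by rewrite D1 mulr0 cos0 mulr1.
- rewrite derive1nS derive1n1 D1 derive1E.
  rewrite (@derive_val _ _ _ _ _ _ _ (is_derive_cos_scaled 1 d^-1 0)).
  by rewrite mulr0 sin0 mulr0.
- move=> t; rewrite normrM (gtr0_norm d0) -[leRHS]mulr1 ler_pM2l//.
  by rewrite ler_norml sin_geN1 sin_le1.
Qed.

End Sine.

Section Subbase.
Context {R : realType} {n : nat} {M : topologicalType} {A : atlas R n M}.

Lemma open_jet2_base (a : chart_index A) (W : set 'cV[R]_(n + (n + n))) :
  open W -> open (jet2_dom a `&` jet2_coord a @^-1` W : set (jet2 A)).
Proof.
move=> oW; set B := _ `&` _.
exists [set B]; last by rewrite bigcup_set1.
move=> _ ->; exists [fset B]%fset.
  by move=> C /fset1P ->; rewrite inE; exists a, W.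
by rewrite set_fset1 bigcap_set1.
Qed.

(** The topology of T2M is generated by a subbase; only finite intersections of
its members are available at first. *)
Lemma jet2_open_finI (O : set (jet2 A)) p : open O -> O p ->
  exists E : {fset (set (jet2 A))},
   [/\ forall B, B \in E -> exists (a : chart_index A) W,
         open W /\ B = jet2_dom a `&` jet2_coord a @^-1` W,
      forall B, B \in E -> B p &
      \bigcap_(B in [set` E]) B `<=` O].
Proof.
move=> [D DfinI <-] [B DB Bp].
have [E ED EB] := DfinI _ DB; exists E; split.
- by move=> C /ED; rewrite inE.
- by move=> C CE; move: Bp; rewrite -EB; apply.
- by move=> q Eq; exists B => //; rewrite -EB.
Qed.

End Subbase.

Section T2Charts.
Context {R : realType} {n : nat} {M : topologicalType} {A : atlas R n M}.
Hypothesis man : smooth_manifold A.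
Local Notation T2 := (T2_atlas A).
Local Notation E2 := 'cV[R]_(n + (n + n)).
Implicit Types (a b : chart_index A) (p q : jet2 A) (w : E2).

Lemma jet2_coordE a p : jet2_coord a p = curve_jet (cmap a \o jet2_rep p).
Proof. by []. Qed.

Lemma xpart_jet2_coord a p : xpart (jet2_coord a p) = cmap a (jet2_rep p 0).
Proof. by rewrite /jet2_coord xpart_col. Qed.

(** The curve qcurve sg w has 2-jet w and stays at distance at most d r from x,
with d r less than the radius of a ball contained in the image of the chart. *)
Lemma jet2_coord_surj a w : cimage a (xpart w) ->
  exists p, jet2_dom a p /\ jet2_coord a p = w.
Proof.
move=> aw; have : nbhs (xpart w) (cimage a).
  by apply: open_nbhs_nbhs; split=> //; exact: open_cimage.
move=> /nbhs_ballP[e /= e0 eU].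
set r := `|ypart w| + `|zpart w| + 1.
have r0 : 0 < r by rewrite ltr_wpDl// addr_ge0.
(* d <= 1 bounds the coefficient sg^2 of z by d as well *)
set d := Num.min 1 (e / 2 / r).
have d0 : 0 < d by rewrite lt_min ltr01 !divr_gt0.
have [sg [sgs sg0 sg1 sg2 sgd]] := bounded_unit_speed d0.
have dr : d * r <= e / 2 by rewrite -ler_pdivlMr// ge_min lexx orbT.
have d1 : d <= 1 by rewrite ge_min lexx.
have cin t : cimage a (qcurve sg w t).
  apply: eU; rewrite -ball_normE /ball_/= opprD addrA subrr sub0r normrN.
  apply: le_lt_trans (_ : e / 2 < e); last lra.
  apply: le_trans dr; apply: le_trans (ler_normD _ _) _; rewrite !normrZ.
  rewrite /r !mulrDr mulr1 -[leLHS]addr0 !lerD ?(ltW d0)// ?ler_wpM2r//.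
  by apply: le_trans (sgd t); rewrite ler_piMl// (le_trans (sgd t)).
have [F [sF aF cF]] := lift_curve_chart man (smooth_on_qcurve w sgs) cin.
have [p pF] := jet2_of_curve sF.
have ap : jet2_dom a p by rewrite /jet2_dom /=; have [-> _] := pF; exact: aF.
exists p; split=> //; rewrite jet2_coordE (same_2jet_curve_jet pF ap) cF.
exact: curve_jet_qcurve.
Qed.

Lemma cimage_T2 a : @cimage _ _ _ T2 a = @xpart R n @^-1` cimage a.
Proof.
apply/seteqP; split=> w.
  by move=> [p ap <-] /=; rewrite xpart_jet2_coord; exists (jet2_rep p 0).
by move=> /jet2_coord_surj[p [ap pw]]; exists p.
Qed.

Lemma coverlap_T2 a b : @coverlap _ _ _ T2 a b = @xpart R n @^-1` coverlap a b.
Proof.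
apply/seteqP; split=> w.
  by move=> [p [ap bp] <-] /=; rewrite xpart_jet2_coord; exists (jet2_rep p 0).
move=> [x [ax bx] xw].
have [|p [ap pw]] := @jet2_coord_surj a w; first by exists x.
exists p => //; split=> //=; have E : jet2_rep p 0 = x.
  by apply: (chart_inj man ap ax); rewrite -xpart_jet2_coord pw xw.
by rewrite /jet2_dom /= E.
Qed.

Lemma jet2_coord_inj a p q : jet2_dom a p -> jet2_dom a q ->
  jet2_coord a p = jet2_coord a q -> p = q.
Proof.
move=> ap aq E; apply: jet2_eq.
exact: (same_2jetP man (jet2_rep_smooth p) (jet2_rep_smooth q) ap aq E).
Qed.

Lemma jet2_coord_transition a b p : jet2_dom a p -> jet2_dom b p ->
  jet2_coord b p = jlift (ctransition a b) (jet2_coord a p).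
Proof. exact: (curve_jet_transition man (jet2_rep_smooth p)). Qed.

Lemma ctransition_T2 a b w : @coverlap _ _ _ T2 a b w ->
  @ctransition _ _ _ T2 a b w = jlift (ctransition a b) w.
Proof.
move=> [p [ap bp] <-]; apply: etrans (jet2_coord_transition ap bp).
apply: (@ctransitionE _ _ _ T2 a b p _ ap bp) => q aq aq'.
exact: (jet2_coord_inj aq aq').
Qed.

Lemma open_overlap_T2 a b : open (@coverlap _ _ _ T2 a b).
Proof. by rewrite coverlap_T2; apply/open_xpart; exact: open_coverlap. Qed.

Lemma smooth_jlift_transition a b :
  smooth_on (@coverlap _ _ _ T2 a b) (jlift (ctransition a b)).
Proof.
rewrite coverlap_T2; apply: smooth_on_jlift; first exact: open_coverlap.
exact: (chart_smooth man).
Qed.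

Lemma smooth_transition_T2 a b :
  smooth_on (@coverlap _ _ _ T2 a b) (@ctransition _ _ _ T2 a b).
Proof.
apply: smooth_on_eq (@smooth_jlift_transition a b); first exact: open_overlap_T2.
by move=> w; move=> /ctransition_T2.
Qed.

(** The members of the subbase refer to all charts, but the coordinates in a
chart b depend continuously on those in a, so that each member contains
a basic neighbourhood in the chart a. *)
Lemma jet2_open_chart (O : set (jet2 A)) a p : open O -> O p -> jet2_dom a p ->
  exists W : set E2, [/\ open W, W (jet2_coord a p) &
    jet2_dom a `&` jet2_coord a @^-1` W `<=` O].
Proof.
move=> oO Op ap; have [E [EP Ep EO]] := jet2_open_finI oO Op.
pose good B := exists W : set E2, [/\ open W, W (jet2_coord a p) &
    jet2_dom a `&` jet2_coord a @^-1` W `<=` B].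
have good1 B : B \in E -> good B.
  move=> BE; have := Ep B BE; have [b [V [oV ->]]] := EP B BE.
  move=> [bp Vp]; exists (@coverlap _ _ _ T2 a b `&`
    jlift (ctransition a b) @^-1` V); split.
  - apply: (open_setI_preimage (@open_overlap_T2 a b) oV) => w ow.
    apply: differentiable_continuous.
    exact: smooth_on_differentiable (@smooth_jlift_transition a b) ow.
  - by split; [exists p|rewrite /= -jet2_coord_transition].
  - move=> q [aq [[q' [aq' bq'] qq'] Vq]].
    have qE : q' = q by exact: jet2_coord_inj aq' aq qq'.
    have bq : jet2_dom b q by rewrite -qE.
    split; first exact: bq.
    rewrite /preimage /mkset (jet2_coord_transition aq bq); exact: Vq.
have goodI B C : good B -> good C -> good (B `&` C).
  move=> [W [oW Wp WB]] [W' [oW' Wp' WC]]; exists (W `&` W'); split => //.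
  - exact: openI.
  - by move=> q [aq [Wq Wq']]; split; [apply: WB|apply: WC].
suff [W [oW Wp WO]] : good (\bigcap_(B in [set` E]) B).
  by exists W; split=> //; exact: subset_trans EO.
rewrite bigcap_fset; rewrite big_seq; apply: (big_ind good) => //.
(* the empty intersection *)
by exists setT; split => //; exact: openT.
Qed.

(** The projection of T2M to M is continuous, since in charts it is the
projection to the x-part. *)
Lemma open_jet2_preim (O : set M) :
  open O -> open [set p : jet2 A | O (jet2_rep p 0)].
Proof.
move=> oO; rewrite openE => p /= Op.
have [a ap] := chart_cover man (jet2_rep p 0).
have oW : open (cmap a @` (O `&` cdom a)).
  apply: (chart_open_map man) => [|x []//].
  by apply: openI => //; exact: (chart_open_dom man).
have := open_jet2_base a (open_xpart oW); set B := _ `&` _ => oB.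
have Bp : B p.
  by split => //=; rewrite xpart_jet2_coord; exists (jet2_rep p 0).
apply: filterS (open_nbhs_nbhs (conj oB Bp)) => q [aq /=].
rewrite xpart_jet2_coord => -[x [Ox ax] xq].
by rewrite -(chart_inj man ax aq xq).
Qed.

Lemma open_jet2_dom a : open (jet2_dom a : set (jet2 A)).
Proof. exact/open_jet2_preim/(chart_open_dom man). Qed.

End T2Charts.

(** The centre and radius are taken in a countable set; this gives a basis of the
topology. *)
Definition ratball (R : realType) m (c : 'cV[rat]_m * nat) : set 'cV[R]_m :=
  ball (map_mx ratr c.1 : 'cV[R]_m) (c.2.+1%:R^-1).

Lemma ratball_basis (R : realType) m (W : set 'cV[R]_m) x :
  nbhs x W -> exists c, ratball c x /\ ratball c `<=` W.
Proof.
move=> /nbhs_ballP[e /= e0 eW].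
have [k /= ke] : exists k, k.+1%:R^-1 < e / 2.
  have e2 : 0 < e / 2 by rewrite divr_gt0.
  exists (Num.truncn (e / 2)^-1).
  by rewrite invf_plt ?posrE// truncnS_gt.
have k0 : 0 < k.+1%:R^-1 :> R by rewrite invr_gt0.
have qP i : exists q : rat,
    ratr q \in `](x i 0 - k.+1%:R^-1), (x i 0 + k.+1%:R^-1)[.
  by apply: rat_in_itvoo; rewrite ltrBlDr -addrA ltrDl addr_gt0.
have [q qx] := choice qP.
have cx : ratball (\col_i q i, k) x.
  split=> //= i j; rewrite !mxE (ord1 j) /ball /=.
  by have := qx i; rewrite in_itv /= -ltr_distlC distrC.
exists (\col_i q i, k); split => // y cy; apply: eW.
apply: (@le_ball _ _ _ (k.+1%:R^-1 + k.+1%:R^-1)).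
  by rewrite [e]splitr lerD ?ltW.
by apply: ball_triangle cy; exact: ball_sym.
Qed.

Section T2Manifold.
Context {R : realType} {n : nat} {M : topologicalType} {A : atlas R n M}.
Hypothesis man : smooth_manifold A.
Local Notation T2 := (T2_atlas A).
Implicit Types (a b : chart_index A) (p q : jet2 A).

Lemma nbhs_jet2_coord a p (W : set 'cV[R]_(n + (n + n))) :
  jet2_dom a p -> nbhs (jet2_coord a p) W ->
  nbhs p (jet2_dom a `&` jet2_coord a @^-1` W).
Proof.
move=> ap; rewrite nbhsE => -[V [oV Vp] VW].
have := open_nbhs_nbhs (conj (open_jet2_base a oV) (conj ap Vp)).
by apply: filterS => q [aq Vq]; split=> //; exact: VW.
Qed.

(** The base points of two jets that are not separated agree, as M is Hausdorff;
the jets then lie in a common chart and have the same coordinates there. *)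
Lemma jet2_hausdorff : hausdorff_space (jet2 A).
Proof.
move=> p q pq.
have nbhs_rep r (O : set M) :
    nbhs (jet2_rep r 0) O -> nbhs r [set s : jet2 A | O (jet2_rep s 0)].
  rewrite nbhsE => -[Q [oQ Qr] QO].
  have Qr' : [set s : jet2 A | Q (jet2_rep s 0)] r := Qr.
  have := open_nbhs_nbhs (conj (open_jet2_preim man oQ) Qr').
  by apply: filterS => s /QO.
have E : jet2_rep p 0 = jet2_rep q 0.
  apply: (manifold_hausdorff man) => O O' /nbhs_rep pO /nbhs_rep qO'.
  have [s [sO sO']] := pq _ _ pO qO'.
  by exists (jet2_rep s 0).
have [a ap] := chart_cover man (jet2_rep p 0).
have aq : jet2_dom a q by rewrite /jet2_dom /mkset -E.
apply: (jet2_coord_inj man ap aq).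
apply: norm_hausdorff => O O' pO qO'.
have [s [[as1 sO] [as2 sO']]] :=
  pq _ _ (nbhs_jet2_coord ap pO) (nbhs_jet2_coord aq qO').
by exists (jet2_coord a s).
Qed.

(** A countable basis B of M has members contained in charts. Choosing one chart
for each of them gives countably many charts that cover M, and the rational
balls in these charts form a basis of T2M. *)
Lemma jet2_second_countable : @second_countable (jet2 A).
Proof.
have [B cB [oB BM]] := manifold_second_countable man.
pose S (z : set M * ('cV[rat]_(n + (n + n)) * nat)) : set (jet2 A) :=
  if pselect (exists a : chart_index A, z.1 `<=` cdom a) is left e
  then jet2_dom (sval (cid e)) `&` jet2_coord (sval (cid e)) @^-1` ratball z.2
  else set0.
exists (S @` (B `*` setT)).
  apply: sub_countable (card_image_le _ _) _.
  by apply: countableX => //; exact: countableP.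
split.
  move=> _ [z _ <-]; rewrite /S; case: pselect => [e|_]; last exact: open0.
  by apply: open_jet2_base; exact: ball_open.
move=> p O; rewrite nbhsE => -[Q [oQ Qp] QO].
have [a ap] := chart_cover man (jet2_rep p 0).
have /BM[U [BU Up] Ua] : nbhs (jet2_rep p 0) (cdom a).
  by apply: open_nbhs_nbhs; split => //; exact: (chart_open_dom man).
have e : exists a : chart_index A, U `<=` cdom a by exists a.
pose a' := sval (cid e); have a'U : U `<=` cdom a' by exact: (svalP (cid e)).
have a'p : jet2_dom a' p by exact: a'U.
have [W [oW Wp WQ]] := jet2_open_chart man oQ Qp a'p.
have [z [zp zW]] := ratball_basis (open_nbhs_nbhs (conj oW Wp)).
have SE : S (U, z) = jet2_dom a' `&` jet2_coord a' @^-1` ratball z.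
  rewrite /S /=; case: pselect => [e'|//].
  by rewrite (Prop_irrelevance e' e).
exists (S (U, z)).
  by split; [exists (U, z)|rewrite SE; split].
rewrite SE => q [aq zq]; apply: QO; apply: WQ; split; first exact: aq.
exact: (zW _ zq).
Qed.

Lemma smooth_manifold_T2 : smooth_manifold T2.
Proof.
split.
- exact: jet2_hausdorff.
- exact: jet2_second_countable.
- by move=> p; have [a ap] := chart_cover man (jet2_rep p 0); exists a.
- exact: (open_jet2_dom man).
- exact: (jet2_coord_inj man).
- move=> a p ap W Wp.
  have := nbhs_jet2_coord ap Wp; apply: filterS => q [_ Wq]; exact: Wq.
- move=> a O oO Oa; rewrite openE => _ [p Op <-].
  have ap := Oa p Op; have [W [oW Wp WO]] := jet2_open_chart man oO Op ap.
  have oI : open (W `&` @cimage _ _ _ T2 a).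
    by apply: openI => //; rewrite (cimage_T2 man); apply/open_xpart/open_cimage.
  have Ip : (W `&` @cimage _ _ _ T2 a) (@jet2_coord _ _ _ A a p).
    by split=> //; exists p.
  apply: filterS (open_nbhs_nbhs (conj oI Ip)) => w [Ww [q aq qw]].
  exists q => //; apply: WO; split; first exact: aq.
  by rewrite /preimage /mkset -[@jet2_coord _ _ _ A a q]/(@cmap _ _ _ T2 a q) qw.
- exact: (smooth_transition_T2 man).
Qed.

End T2Manifold.

(** * Block matrices of the lifted tensors *)

Section BlockAlgebra.
Context {R : comNzRingType} {n : nat}.
Implicit Types (G H J : 'M[R]_n) (x y z : 'cV[R]_n).

(** All the 3n x 3n matrices below are built from n x n blocks; block3 hides the
nesting that the type n + (n + n) imposes. *)
Definition block3 (a11 a12 a13 a21 a22 a23 a31 a32 a33 : 'M[R]_n) :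
    'M[R]_(n + (n + n)) :=
  block_mx a11 (row_mx a12 a13) (col_mx a21 a31) (block_mx a22 a23 a32 a33).

Lemma tr_block3 a11 a12 a13 a21 a22 a23 a31 a32 a33 :
  (block3 a11 a12 a13 a21 a22 a23 a31 a32 a33)^T =
  block3 a11^T a21^T a31^T a12^T a22^T a32^T a13^T a23^T a33^T.
Proof. by rewrite /block3 !(tr_block_mx, tr_row_mx, tr_col_mx). Qed.

Lemma mul_block3 a11 a12 a13 a21 a22 a23 a31 a32 a33
    b11 b12 b13 b21 b22 b23 b31 b32 b33 :
  block3 a11 a12 a13 a21 a22 a23 a31 a32 a33 *m
  block3 b11 b12 b13 b21 b22 b23 b31 b32 b33 =
  block3
    (a11 *m b11 + (a12 *m b21 + a13 *m b31))
    (a11 *m b12 + (a12 *m b22 + a13 *m b32))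
    (a11 *m b13 + (a12 *m b23 + a13 *m b33))
    (a21 *m b11 + (a22 *m b21 + a23 *m b31))
    (a21 *m b12 + (a22 *m b22 + a23 *m b32))
    (a21 *m b13 + (a22 *m b23 + a23 *m b33))
    (a31 *m b11 + (a32 *m b21 + a33 *m b31))
    (a31 *m b12 + (a32 *m b22 + a33 *m b32))
    (a31 *m b13 + (a32 *m b23 + a33 *m b33)).
Proof.
rewrite /block3 mulmx_block mul_row_col mul_mx_row mul_row_block add_row_mx.
by rewrite mul_col_mx mul_block_col add_col_mx mul_col_row mulmx_block add_block_mx.
Qed.

Lemma block3_col a11 a12 a13 a21 a22 a23 a31 a32 a33 x y z :
  block3 a11 a12 a13 a21 a22 a23 a31 a32 a33 *m col_mx x (col_mx y z) =
  col_mx (a11 *m x + (a12 *m y + a13 *m z))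
    (col_mx (a21 *m x + (a22 *m y + a23 *m z))
            (a31 *m x + (a32 *m y + a33 *m z))).
Proof.
by rewrite /block3 mul_block_col mul_row_col mul_col_mx mul_block_col add_col_mx.
Qed.

(** The bilinear form that sends v(e) and w(e) to the coefficient of e^2 in
G(e)(v(e), w(e)), where G(e) = G0 + G1 e + G2 e^2 and e^3 = 0. *)
Definition lift_mx G0 G1 G2 := block3 G2 G1 G0 G1 G0 0 G0 0 0.

(** Multiplication by e. *)
Definition nil_mx : 'M[R]_(n + (n + n)) := block3 0 0 0 1%:M 0 0 0 1%:M 0.

(** Multiplication by J0 + J1 e + J2 e^2. *)
Definition jac_lift_mx J0 J1 J2 := block3 J0 0 0 J1 J0 0 J2 J1 J0.

Definition simp3 := (mul0mx, mulmx0, mul1mx, mulmx1, addr0, add0r).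

Lemma nil_mx_col x y z :
  nil_mx *m col_mx x (col_mx y z) = col_mx 0 (col_mx x y).
Proof. by rewrite block3_col !simp3. Qed.

Lemma nil_mx_cube : nil_mx *m nil_mx *m nil_mx = 0.
Proof.
by rewrite !mul_block3 !simp3 /block3 row_mx0 col_mx0 !block_mx0.
Qed.

Lemma nil_mx_neq0 : (0 < n)%N -> nil_mx <> 0.
Proof.
move=> n0 E; pose i0 := Ordinal n0.
have : nil_mx (rshift n (lshift n i0)) (lshift _ i0) = 0 by rewrite E mxE.
rewrite /nil_mx /block3 block_mxEdl col_mxEu mxE eqxx => /eqP.
by rewrite oner_eq0.
Qed.

Lemma jac_lift_mx_col J0 J1 J2 x y z :
  jac_lift_mx J0 J1 J2 *m col_mx x (col_mx y z) =
  col_mx (J0 *m x) (col_mx (J1 *m x + J0 *m y) (J2 *m x + (J1 *m y + J0 *m z))).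
Proof. by rewrite block3_col !simp3. Qed.

(** Both are multiplications by elements of a ring in which e is central. *)
Lemma nil_jac_lift_mx J0 J1 J2 :
  nil_mx *m jac_lift_mx J0 J1 J2 = jac_lift_mx J0 J1 J2 *m nil_mx.
Proof. by rewrite !mul_block3 !simp3. Qed.

(** Multiplying an argument by e multiplies the value by e, which shifts the
coefficients of G. *)
Lemma tr_nil_mx_lift_mx G0 G1 G2 :
  nil_mx^T *m lift_mx G0 G1 G2 = lift_mx 0 G0 G1.
Proof. by rewrite tr_block3 !(trmx0, trmx1) mul_block3 !simp3. Qed.

Lemma lift_mx_nil_mx G0 G1 G2 :
  lift_mx G0 G1 G2 *m nil_mx = lift_mx 0 G0 G1.
Proof. by rewrite mul_block3 !simp3. Qed.

Lemma tr_lift_mx G0 G1 G2 : (lift_mx G0 G1 G2)^T = lift_mx G0^T G1^T G2^T.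
Proof. by rewrite tr_block3 !trmx0. Qed.

(** The coefficients of J(e)^T H(e) J(e). *)
Lemma lift_mx_congruence J0 J1 J2 H0 H1 H2 :
  let P0 := J0^T *m H0 in
  let P1 := J1^T *m H0 + J0^T *m H1 in
  let P2 := J2^T *m H0 + J1^T *m H1 + J0^T *m H2 in
  (jac_lift_mx J0 J1 J2)^T *m lift_mx H0 H1 H2 *m jac_lift_mx J0 J1 J2 =
  lift_mx (P0 *m J0) (P1 *m J0 + P0 *m J1)
          (P2 *m J0 + P1 *m J1 + P0 *m J2).
Proof.
move=> P0 P1 P2; rewrite tr_block3 !trmx0 !mul_block3 !simp3 /lift_mx.
have -> : J0^T *m H1 + J1^T *m H0 = P1 by rewrite addrC.
congr block3; rewrite addrA; congr (_ *m _ + _ + _).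
by rewrite addrC [J1^T *m H1 + _]addrC.
Qed.

End BlockAlgebra.

Section DeriveLiftMx.
Context {R : realType} {V : normedModType R}.
Context (n : nat) (U : set V) (G0 G1 G2 : V -> 'M[R]_n).
Hypotheses (oU : open U).
Hypotheses (s0 : smooth_on U G0) (s1 : smooth_on U G1) (s2 : smooth_on U G2).

Lemma smooth_on_lift_mx : smooth_on U (fun x => lift_mx (G0 x) (G1 x) (G2 x)).
Proof.
have sc m1 m2 (c : 'M[R]_(m1, m2)) : smooth_on U (fun _ : V => c).
  exact: smooth_on_cst.
apply: smooth_on_col_mx => //; apply: smooth_on_row_mx => //.
- exact: smooth_on_row_mx.
- exact: smooth_on_col_mx.
- apply: smooth_on_col_mx => //; apply: smooth_on_row_mx => //; exact: sc.
Qed.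

Lemma derive_lift_mx x v : U x ->
  'D_v (fun x => lift_mx (G0 x) (G1 x) (G2 x)) x =
  lift_mx ('D_v G0 x) ('D_v G1 x) ('D_v G2 x).
Proof.
move=> Ux.
have sc m1 m2 (c : 'M[R]_(m1, m2)) : smooth_on U (fun _ : V => c).
  exact: smooth_on_cst.
have sr12 := smooth_on_row_mx oU s1 s0.
have sc12 := smooth_on_col_mx oU s1 s0.
have sr00 := smooth_on_row_mx oU s0 (sc _ _ (0 : 'M[R]_n)).
have sz := smooth_on_row_mx oU (sc _ _ (0 : 'M[R]_n)) (sc _ _ (0 : 'M[R]_n)).
have sb := smooth_on_col_mx oU sr00 sz.
have su := smooth_on_row_mx oU s2 sr12.
have sd := smooth_on_row_mx oU sc12 sb.
have D0 : 'D_v (fun _ => 0 : 'M[R]_n) x = 0 by exact: derive_cst.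
rewrite [LHS](derive_col_mx v oU su sd Ux).
rewrite (derive_row_mx v oU s2 sr12 Ux) (derive_row_mx v oU sc12 sb Ux).
rewrite (derive_row_mx v oU s1 s0 Ux) (derive_col_mx v oU s1 s0 Ux).
rewrite (derive_col_mx v oU sr00 sz Ux) (derive_row_mx v oU s0 (sc _ _ _) Ux).
by rewrite (derive_row_mx v oU (sc _ _ _) (sc _ _ _) Ux) D0.
Qed.

End DeriveLiftMx.

Section Bilin.
Context {R : realType} {m : nat}.
Implicit Types (h J K : 'M[R]_m) (v w : 'cV[R]_m).

Lemma bilin_eqP h h' : (forall v w, bilin h v w = bilin h' v w) <-> h = h'.
Proof.
split=> [E|-> //]; apply/matrixP => i j.
have := E (delta_mx i 0) (delta_mx j 0).
by rewrite /bilin !trmx_delta -!rowE -!colE !mxE.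
Qed.

Lemma bilin_mul h J K v w : bilin h (J *m v) (K *m w) = bilin (J^T *m h *m K) v w.
Proof. by rewrite /bilin trmx_mul !mulmxA. Qed.

Lemma bilinBl h v v' w : bilin h (v - v') w = bilin h v w - bilin h v' w.
Proof. by rewrite /bilin linearB /= !mulmxBl !mxE. Qed.

Lemma bilinBr h v w w' : bilin h v (w - w') = bilin h v w - bilin h v w'.
Proof. by rewrite /bilin mulmxBr !mxE. Qed.

Lemma derive_bilin (V : normedModType R) (h : V -> 'M[R]_m) (Y Z : V -> 'cV[R]_m)
    u (v : V) : differentiable h u -> differentiable Y u -> differentiable Z u ->
  'D_v (fun x => bilin (h x) (Y x) (Z x)) u =
  bilin ('D_v h u) (Y u) (Z u) + bilin (h u) ('D_v Y u) (Z u) +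
  bilin (h u) (Y u) ('D_v Z u).
Proof.
move=> dh dY dZ.
have dYT : differentiable (trmx \o Y) u.
  by apply: differentiable_comp => //; exact: mx_linear_differentiable.
have dYh : differentiable (fun x => (Y x)^T *m h x) u.
  apply/differentiable_mxP => i j.
  rewrite (_ : (fun x => _) = \sum_k (fun x => Y x k i * h x k j)).
    apply: differentiable_sum => k; apply: differentiableM.
      by move: k i; apply/differentiable_mxP.
    by move: k j; apply/differentiable_mxP.
  by apply/funext => x; rewrite fct_sumE mxE; apply: eq_bigr => k _; rewrite mxE.
have dYhZ : differentiable (fun x => (Y x)^T *m h x *m Z x) u.
  apply/differentiable_mxP => i j.
  rewrite (_ : (fun x => _) = \sum_k (fun x => ((Y x)^T *m h x) i k * Z x k j)).
    apply: differentiable_sum => k; apply: differentiableM.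
      by move: i k; apply/differentiable_mxP.
    by move: k j; apply/differentiable_mxP.
  by apply/funext => x; rewrite fct_sumE mxE.
rewrite /bilin -(derive_mxE v 0 0 dYhZ) (derive_mulmx v dYh dZ).
rewrite (derive_mulmx v dYT dh) (derive_linear_comp trmx v dY).
rewrite mulmxDl [LHS]mxE [X in X + _]mxE.
by apply: (f_equal (fun r => r + _)); exact: addrC.
Qed.

End Bilin.

Lemma add_congruence (R : pzRingType) n (a p h c k x y : 'M[R]_n) :
  (a + p *m h) *m k + x + y + p *m c *m k = (a + p *m (h + c)) *m k + x + y.
Proof. by rewrite mulmxDr addrA [in RHS]mulmxDl addrAC (addrAC _ x). Qed.

(** * Transformation laws *)

Section Jacobian.
Context {R : realType} {n : nat} (U : set 'cV[R]_n) (phi : 'cV[R]_n -> 'cV[R]_n).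
Hypotheses (oU : open U) (sphi : smooth_on U phi).

Definition jac (f : 'cV[R]_n -> 'cV[R]_n) x : 'M[R]_n :=
  \matrix_(i, j) partial j f x i 0.

Lemma jacE x v : U x -> 'D_v phi x = jac phi x *m v.
Proof.
move=> Ux; rewrite (derive_coord _ (smooth_on_differentiable sphi Ux)).
apply/matrixP => i j; rewrite (ord1 j) summxE !mxE; apply: eq_bigr => s _.
by rewrite !mxE mulrC.
Qed.

Lemma smooth_on_jac : smooth_on U (jac phi).
Proof.
apply/smooth_on_mxP => // i j.
rewrite (_ : (fun x => _) = (fun x => partial j phi x i 0)).
  by move: i (0 : 'I_1); apply/smooth_on_mxP => //; exact: smooth_on_partial.
by apply/funext => x; rewrite mxE.
Qed.

Definition jac_lift w :=
  jac_lift_mx (jac phi (xpart w)) (lift1 (jac phi) w) (lift2 (jac phi) w).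

(** The derivative of the prolonged map along v is the prolongation of
x |-> J x v(e), with J the Jacobian matrix of phi. *)
Lemma derive_jlift w v : U (xpart w) -> 'D_v (jlift phi) w = jac_lift w *m v.
Proof.
move=> Ux; have oX := open_xpart oU; have sJ := smooth_on_jac.
have s0 := smooth_on_xpart_comp oU sphi.
have s1 := smooth_on_lift1 oU sphi; have s2 := smooth_on_lift2 oU sphi.
have L1 u : lift1 (fun x => 'D_u phi x) w = lift1 (jac phi) w *m u.
  apply: etrans (lift1_linear (mulmxr u) sJ Ux).
  by apply: (eq_lift1 oU _ Ux) => x Ux'; exact: jacE.
have L2 u : lift2 (fun x => 'D_u phi x) w = lift2 (jac phi) w *m u.
  apply: etrans (lift2_linear (mulmxr u) oU sJ Ux).
  by apply: (eq_lift2 oU _ Ux) => x Ux'; exact: jacE.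
rewrite -[in RHS](partE v) jac_lift_mx_col.
apply: etrans (derive_col_mx v oX s0 (smooth_on_col_mx oX s1 s2) Ux) _.
have E0 : 'D_v (fun w => phi (xpart w)) w = jac phi (xpart w) *m xpart v.
  exact: (etrans (derive_linear_arg (@xpart R n) phi w v) (jacE (xpart v) Ux)).
apply: (f_equal2 col_mx E0).
apply: etrans (derive_col_mx v oX s1 s2 Ux) (f_equal2 col_mx _ _).
  by apply: etrans (derive_lift1 v oU sphi Ux) _; rewrite L1 (jacE _ Ux).
apply: etrans (derive_lift2 v oU sphi Ux) _.
by rewrite L1 L2 (jacE _ Ux) addrA.
Qed.

End Jacobian.

Section LiftTensor.
Context {R : realType} {n : nat} {M : topologicalType} {A : atlas R n M}.
Hypothesis man : smooth_manifold A.
Local Notation T2 := (T2_atlas A).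
Implicit Types (a b : chart_index A) (w v : 'cV[R]_(n + (n + n))).

Lemma ctransition_coverlap a b x :
  coverlap a b x -> cimage b (ctransition a b x).
Proof. by move=> [p [ap bp] <-]; rewrite (transition_cmap man ap bp); exists p. Qed.

(** The transformation law of a (0,2)-tensor in matrix form, which unlike the law
for fixed vectors can be differentiated as an identity of functions of x. *)
Lemma tensor02_jac (h : mx_components A) : tensor02 h ->
  forall a b x, coverlap a b x -> h a x =
    (jac (ctransition a b) x)^T *m h b (ctransition a b x)
      *m jac (ctransition a b) x.
Proof.
move=> [_ hT] a b x abx; apply/bilin_eqP => v w; rewrite (hT a b x abx).
have J u := jacE (@chart_smooth _ _ _ _ man a b) u abx.
by rewrite !J bilin_mul.
Qed.

Lemma deformed_liftE (g c : mx_components A) a w :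
  deformed_lift g c a w =
  lift_mx (g a (xpart w)) (lift1 (g a) w) (lift2 (g a) w + c a (xpart w)).
Proof. by []. Qed.

Lemma smooth_deformed_lift (g c : mx_components A) a :
  smooth_on (cimage a) (g a) -> smooth_on (cimage a) (c a) ->
  smooth_on (@cimage _ _ _ T2 a) (deformed_lift g c a).
Proof.
move=> sg sc; rewrite (cimage_T2 man).
have oC : open (cimage a) by exact: open_cimage.
have oX := open_xpart oC.
apply: smooth_on_lift_mx => //; first exact: smooth_on_xpart_comp.
  exact: smooth_on_lift1.
by apply: smooth_onD => //; [exact: smooth_on_lift2|exact: smooth_on_xpart_comp].
Qed.

Lemma derive_transition_T2 a b w v : @coverlap _ _ _ T2 a b w ->
  'D_v (@ctransition _ _ _ T2 a b) w = jac_lift (ctransition a b) w *m v.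
Proof.
move=> abw; rewrite (near_eq_derive (g := jlift (ctransition a b))); last first.
  apply: open_eq_near (@open_overlap_T2 _ _ _ _ man a b) abw _ => u.
  exact: ctransition_T2.
have abx : coverlap a b (xpart w) by rewrite (coverlap_T2 man) in abw.
exact: (derive_jlift (@open_coverlap _ _ _ _ man a b)
  (@chart_smooth _ _ _ _ man a b) v abx).
Qed.

(** Differentiating the transformation law of g by lift_congruence gives the
coefficients computed by lift_mx_congruence; c contributes a term of order
e^2, on which only J0 acts. *)
Lemma deformed_lift_transition (g c : mx_components A) a b w :
  tensor02 g -> tensor02 c -> coverlap a b (xpart w) ->
  deformed_lift g c a w =
    (jac_lift (ctransition a b) w)^T
      *m deformed_lift g c b (jlift (ctransition a b) w)
      *m jac_lift (ctransition a b) w.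
Proof.
move=> tg tc abx; set phi := ctransition a b.
have sphi : smooth_on (coverlap a b) phi := @chart_smooth _ _ _ _ man a b.
have oU : open (coverlap a b) by exact: open_coverlap.
have oV : open (cimage b) by exact: open_cimage.
have sJ := smooth_on_jac oU sphi.
have UV : coverlap a b `<=` phi @^-1` cimage b by exact: ctransition_coverlap.
have sgb : smooth_on (cimage b) (g b) by case: tg.
have sgphi := smooth_on_comp oU UV sphi sgb.
have [E1 E2] := lift_congruence oU sJ sgphi abx.
have [E5 E6] := lift_comp oU oV UV sphi sgb abx.
have gaE x : coverlap a b x -> g a x = _ := tensor02_jac tg (x := x).
rewrite (deformed_liftE g c a w) (deformed_liftE g c b) lift_mx_congruence.
have xj : xpart (jlift phi w) = phi (xpart w) by exact: xpart_col.
rewrite xj -E5 -E6; apply: (f_equal3 (@lift_mx R n)).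
- exact: gaE abx.
- exact: etrans (eq_lift1 oU gaE abx) E1.
- have Ec := tensor02_jac tc abx.
  apply: etrans (f_equal2 +%R (etrans (eq_lift2 oU gaE abx) E2) Ec) _.
  exact: add_congruence.
Qed.

Lemma tensor02_deformed_lift (g c : mx_components A) :
  tensor02 g -> tensor02 c -> tensor02 (A := T2) (deformed_lift g c).
Proof.
move=> tg tc; split=> [a|a b w abw v u].
  by apply: smooth_deformed_lift; [case: tg|case: tc].
have abx : @coverlap _ _ _ A a b (xpart w) by rewrite (coverlap_T2 man) in abw.
rewrite !(derive_transition_T2 _ abw) bilin_mul (ctransition_T2 man abw).
by rewrite -(deformed_lift_transition tg tc abx).
Qed.

Lemma tensor11_gamma_hat : tensor11 (A := T2) (gamma_hat A).
Proof.
split=> [a|a b w abw v]; first exact: smooth_on_cst.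
rewrite !(derive_transition_T2 _ abw) !mulmxA.
exact: (f_equal (mulmx^~ v) (nil_jac_lift_mx _ _ _)).
Qed.

End LiftTensor.

(** * The holomorphy condition *)

Lemma bilin_nondegenerateP (R : realType) m (h : 'M[R]_m) v :
  (forall w, bilin h v w = 0) <-> v^T *m h = 0.
Proof.
split=> [E|E w]; last by rewrite /bilin E mul0mx mxE.
apply/matrixP => i j; rewrite (ord1 i) [RHS]mxE -(E (delta_mx j 0)).
by rewrite /bilin -colE [RHS]mxE.
Qed.

Lemma row_lift_mx (R : realType) n (G0 G1 G2 : 'M[R]_n) (x y z : 'cV[R]_n) :
  (col_mx x (col_mx y z))^T *m lift_mx G0 G1 G2 =
  row_mx (x^T *m G2 + (y^T *m G1 + z^T *m G0))
    (row_mx (x^T *m G1 + y^T *m G0) (x^T *m G0)).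
Proof.
rewrite /lift_mx /block3 !tr_col_mx mul_row_block mul_row_col mul_mx_row.
by rewrite mul_row_block add_row_mx !mulmx0 !addr0.
Qed.

(** The matrix is block triangular with respect to the antidiagonal, so that the
equations determine v0, v1 and v2 one after the other. *)
Lemma lift_mx_nondegenerate (R : realType) n (G0 G1 G2 : 'M[R]_n) :
  (forall v, (forall w, bilin G0 v w = 0) -> v = 0) ->
  forall v, (forall w, bilin (lift_mx G0 G1 G2) v w = 0) -> v = 0.
Proof.
move=> nd v /bilin_nondegenerateP; rewrite -(partE v) row_lift_mx -!row_mx0.
have inj (x : 'cV[R]_n) : x^T *m G0 = 0 -> x = 0.
  by move=> E; apply: nd; exact/bilin_nondegenerateP.
move=> /eq_row_mx[E2 /eq_row_mx[E1 /inj E0]].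
move: E1 E2; rewrite E0 trmx0 !mul0mx !add0r => /inj ->.
by rewrite trmx0 mul0mx add0r => /inj ->; rewrite !col_mx0.
Qed.

(** For a constant endomorphism field K, (L_Y K) X = K D_X Y - D_(K X) Y. By the
purity of h the derivatives of X, Y and Z cancel, and the condition on the
derivatives of h disposes of the two remaining terms. *)
Lemma tachibana_const (R : realType) m (N : Type) (B : atlas R m N)
    (K : 'M[R]_m) (h : mx_components B) (X Y Z : vec_components B) a u :
  differentiable (h a) u -> differentiable (X a) u ->
  differentiable (Y a) u -> differentiable (Z a) u ->
  K^T *m h a u = h a u *m K ->
  (forall v, 'D_(K *m v) (h a) u = K^T *m 'D_v (h a) u) ->
  tachibana (fun _ _ => K) h X Y Z a u = 0.
Proof.
move=> dh dX dY dZ hK DhK.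
have DK (V : 'cV[R]_m -> 'cV[R]_m) v : differentiable V u ->
    'D_v (fun x => K *m V x) u = K *m 'D_v V u.
  exact: (derive_linear_comp (mulmx K)).
have dKY : differentiable (fun x => K *m Y a x) u.
  apply: (@differentiable_comp _ _ _ _ (Y a) (mulmx K)) => //.
  exact: mx_linear_differentiable.
have lieE (V : vec_components B) : differentiable (V a) u ->
    lie_tensor11 V (fun _ _ => K) X a u =
    K *m 'D_(X a u) (V a) u - 'D_(K *m X a u) (V a) u.
  move=> dV; rewrite /lie_tensor11 /lie_bracket /tapply (DK (X a) _ dX) mulmxBr.
  by rewrite opprB addrC addrA subrK.
have KlR x y : bilin (h a u) (K *m x) y = bilin (h a u) x (K *m y).
  by rewrite /bilin trmx_mul -[_ *m K^T *m _]mulmxA hK !mulmxA.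
have KlD x y v :
    bilin ('D_v (h a) u) (K *m x) y = bilin ('D_(K *m v) (h a) u) x y.
  by rewrite /bilin trmx_mul -[_ *m K^T *m _]mulmxA -DhK.
rewrite /tachibana /vderive /pairing (lieE Y dY) (lieE Z dZ) /tapply.
rewrite (derive_bilin _ dh dY dZ) (derive_bilin _ dh dKY dZ) (DK (Y a) _ dY).
rewrite bilinBl bilinBr !KlD !KlR.
ring.
Qed.

Section Main.
Context {R : realType} {n : nat} {M : topologicalType} {A : atlas R n M}.
Hypothesis man : smooth_manifold A.
Local Notation T2 := (T2_atlas A).

Lemma nilpotent_gamma_hat : (0 < n)%N -> [set: M] !=set0 ->
  nilpotent_structure (A := T2) (gamma_hat A).
Proof.
move=> n0 [p _]; split.
- exact: tensor11_gamma_hat.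
- have [a ap] := chart_cover man p.
  exists a, (col_mx (cmap a p) 0); split; last exact: nil_mx_neq0.
  by rewrite (cimage_T2 man) /preimage /mkset /xpart col_mxKu; exists p.
- move=> a w _; exact: nil_mx_cube.
Qed.

Lemma pseudo_riemannian_deformed_lift (g c : mx_components A) :
  pseudo_riemannian g -> symmetric_tensor02 c ->
  pseudo_riemannian (A := T2) (deformed_lift g c).
Proof.
move=> [[tg symg] ndg] [tc symc]; split.
  split; first exact: tensor02_deformed_lift.
  move=> a w; rewrite (cimage_T2 man) => aw.
  have oC : open (@cimage _ _ _ A a) by exact: open_cimage.
  have sga : smooth_on (@cimage _ _ _ A a) (g a) by case: tg.
  rewrite (@deformed_liftE _ _ _ A) tr_lift_mx.
  apply: (f_equal3 (@lift_mx R n)).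
  - exact: symg.
  - apply: etrans (esym (lift1_linear trmx sga aw)) _.
    exact: (eq_lift1 oC (symg a) aw).
  - rewrite linearD /=; apply: (f_equal2 +%R); last exact: symc.
    apply: etrans (esym (lift2_linear trmx oC sga aw)) _.
    exact: (eq_lift2 oC (symg a) aw).
move=> a w; rewrite (cimage_T2 man) => aw.
exact: (lift_mx_nondegenerate (ndg a (xpart w) aw)).
Qed.

Lemma B_metric_deformed_lift (g c : mx_components A) :
  pseudo_riemannian g -> symmetric_tensor02 c ->
  B_metric (A := T2) (gamma_hat A) (deformed_lift g c).
Proof.
move=> hg hc; split; first exact: pseudo_riemannian_deformed_lift.
move=> X Y _ _ a w _; rewrite /pairing /tapply /bilin trmx_mul.
rewrite -[_ *m (gamma_hat A a w)^T *m _]mulmxA.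
rewrite [X in (_ *m X *m _) 0 0](tr_nil_mx_lift_mx _ _ _).
by rewrite mulmxA -[_ *m deformed_lift g c a w *m _]mulmxA
  [X in _ = (_ *m X *m _) 0 0](lift_mx_nil_mx _ _ _).
Qed.

(** The deformed lift is differentiable over R[e]/(e^3): the derivative along
e v is e times the derivative along v. By derive_lift1 and derive_lift2 both
sides have the coefficients 0, D_(v0) g and D_v (lift1 g). *)
Lemma derive_deformed_lift_nil (g c : mx_components A) (a : chart_index A) w v :
  smooth_on (cimage a) (g a) -> smooth_on (cimage a) (c a) ->
  cimage a (xpart w) ->
  'D_(nil_mx *m v) (deformed_lift g c a) w =
  nil_mx^T *m 'D_v (deformed_lift g c a) w.
Proof.
move=> sg sc aw; have oC : open (cimage a) by exact: open_cimage.
have oX := open_xpart oC.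
have sgx := smooth_on_xpart_comp oC sg; have scx := smooth_on_xpart_comp oC sc.
have s1 := smooth_on_lift1 oC sg; have s2 := smooth_on_lift2 oC sg.
have s2c := smooth_onD oX s2 scx.
have Dh u : 'D_u (deformed_lift g c a) w =
    lift_mx ('D_(xpart u) (g a) (xpart w))
      (lift1 (fun x => 'D_(xpart u) (g a) x) w + 'D_(ypart u) (g a) (xpart w))
      (lift2 (fun x => 'D_(xpart u) (g a) x) w +
       lift1 (fun x => 'D_(ypart u) (g a) x) w +
       'D_(zpart u) (g a) (xpart w) + 'D_(xpart u) (c a) (xpart w)).
  apply: etrans (derive_lift_mx oX sgx s1 s2c u aw) _.
  apply: (f_equal3 (@lift_mx R n)).
  - exact: (derive_linear_arg (@xpart R n) (g a) w u).
  - exact: derive_lift1 oC sg aw.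
  - apply: etrans (deriveD _ _) _.
    + apply: diff_derivable; exact: smooth_on_differentiable s2 aw.
    + apply: diff_derivable; exact: smooth_on_differentiable scx aw.
    apply: (f_equal2 +%R); first exact: derive_lift2 oC sg aw.
    exact: (derive_linear_arg (@xpart R n) (c a) w u).
have D0 : (fun x => 'D_0 (g a) x) = (fun _ => 0).
  by apply/funext => x; exact: derive0.
have partial0 s : partial s (fun _ : 'cV[R]_n => 0 : 'M[R]_n) = (fun _ => 0).
  by apply/funext => x; exact: derive_cst.
have L10 : lift1 (fun _ => 0 : 'M[R]_n) w = 0.
  by rewrite /lift1 big1// => s _; rewrite partial0 scaler0.
have L20 : lift2 (fun _ => 0 : 'M[R]_n) w = 0.
  rewrite lift2E !big1 ?scaler0 ?addr0// => s _; rewrite partial0 ?scaler0//.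
  by rewrite L10 scaler0.
have E : nil_mx *m v = col_mx 0 (col_mx (xpart v) (ypart v)).
  by rewrite -[in LHS](partE v) nil_mx_col.
rewrite (Dh (nil_mx *m v)) E xpart_col ypart_col zpart_col D0 L10 L20.
by rewrite !derive0 !add0r addr0 (Dh v) tr_nil_mx_lift_mx.
Qed.

End Main.

Theorem theorem2 (R : realType) (n : nat) (M : topologicalType)
    (A : atlas R n M) (g c : mx_components A)
    (n_gt0 : (0 < n)%N)
    (M_nonempty : [set: M] !=set0)
    (M_manifold : smooth_manifold A)
    (g_metric : pseudo_riemannian g)
    (c_symmetric : symmetric_tensor02 c) :
  plural_holomorphic_B_manifold (A := T2_atlas A) (gamma_hat A)
    (deformed_lift g c).
Proof.
split.
- exact: smooth_manifold_T2.
- exact: nilpotent_gamma_hat.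
- exact: B_metric_deformed_lift.
move=> X Y Z [sX _] [sY _] [sZ _] a w aw.
have sg : smooth_on (@cimage _ _ _ A a) (g a) by case: g_metric => -[[]].
have sc : smooth_on (@cimage _ _ _ A a) (c a) by case: c_symmetric => -[].
have ax : @cimage _ _ _ A a (xpart w) by rewrite (cimage_T2 M_manifold) in aw.
have sh := smooth_deformed_lift M_manifold sg sc.
apply: (@tachibana_const _ _ _ (T2_atlas A) nil_mx).
- exact: smooth_on_differentiable sh aw.
- exact: smooth_on_differentiable (sX a) aw.
- exact: smooth_on_differentiable (sY a) aw.
- exact: smooth_on_differentiable (sZ a) aw.
- exact: etrans (tr_nil_mx_lift_mx _ _ _) (esym (lift_mx_nil_mx _ _ _)).
- move=> v; exact: (derive_deformed_lift_nil M_manifold v sg sc ax).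
Qed.
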